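(* Let $\alpha>2$, $\lambda>0$, $\beta>0$, $H(w)=1-w^2$, and let $f=f(w,t)$ be a smooth nonnegative solution, with initial datum $f_0\ge0$, of $$\frac{\partial}{\partial t} f(w,t) = \frac{\partial}{\partial w} \left[ wf(w,t)\left(1+\beta H^\alpha(w) f^\alpha(w,t)\right) + \lambda \frac{\partial}{\partial w} (H(w)f(w,t))\right],\qquad w\in[-1,1],$$ with no-flux boundary conditions at $w=\pm1$. Let $\mu=\int_{-1}^1 f_0(w)\,dw$ and $E(t)=\int_{-1}^1 w^2f(w,t)\,dw$. Let $c_{\alpha} = \left( \frac{2\alpha}{\alpha-2} \right)^{\frac{\alpha}{\alpha+1}}$ and $d_\alpha = \left[\frac{2(\alpha+1)}{c_\alpha(\alpha-2)} \right]^{\frac{1}{3}}$. Define $$\Phi(E(0)) = 2\lambda \mu -\frac{2\beta}{\left(c_\alpha d_\alpha + d_\alpha^{-2} \right)^{\frac{3\alpha}{2}}}\,\frac{(\mu-E(0))^{\frac{3\alpha}{2}}}{E^{\frac{\alpha-2}{2}}(0)},$$ $$\Psi(\mu) = 2\lambda - \frac{2\beta}{\left(c_\alpha d_\alpha + d_\alpha^{-2} \right)^{\frac{3\alpha}{2}}}\,\mu^{\alpha+1}\,\frac{(1-E(0))^{\frac{3\alpha}{2}}}{E^{\frac{\alpha-2}{2}}(0)}.$$ (a) $\Phi(E(0))<0$ provided $E(0)$ is sufficiently small: there exists $0<E_c<\mu$ such that $\Phi(E(0))<0$ whenever $E(0)<E_c$. (b) For given $E(0)$, $\Psi(\mu)<0$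 provided the initial mass is sufficiently large: $$\mu > \left( \frac{\lambda}{\beta \left(c_\alpha d_\alpha + d_\alpha^{-2} \right)^{\frac{3}{2\alpha}} }\, \frac{E^{\frac{\alpha-2}{2}}(0)}{ (1-E(0))^{\frac{3\alpha}{2}}} \right)^{\frac{1}{\alpha+1}}.$$ (c) Suppose that $\Phi(E(0))<0$ or $\Psi(\mu)<0$, corresponding to a sufficiently small initial energy or a sufficiently large initial mass, respectively. Set $$\Lambda = \frac{2\beta (\mu-E(0))^{\frac{3}{2\alpha}}}{\left(c_\alpha d_\alpha + d_\alpha^{-2} \right)^{\frac{3}{2\alpha}}},\qquad \gamma = \frac{\alpha-2}{2\alpha^2}\in\left(0,\tfrac1{16}\right).$$ Then $$\frac{d}{dt}E(t)\le 2\lambda\mu-\frac{\Lambda}{E^\gamma(t)}\le-\frac{\Lambda-2\lambda\mu E^\gamma(0)}{E^\gamma(t)},$$ $$E^{\gamma+1}(t) \le E^{\gamma+1}(0) - (\gamma+1)\left(\Lambda-2\lambda \mu E^{\gamma}(0)\right)t,$$ and at the time $$\bar t = \frac{E^{\gamma+1}(0)}{(\gamma+1)\left(\Lambda-2\lambda \mu E^\gamma(0)\right)}$$ one has $E(\bar t)=0$. This contradicts the inequality $$\int_{-1}^1 w^2 f(w,t)\, dw \ge \left(\frac 15\right)^5\frac{(2 \sqrt 2)^4\mu^5}{\left(\int_{-1}^1 f^2(w,t)\, dw\right)^{2}}$$ unless the $L^2$-norm of the solution blows up. The time $\bar t$ is positive provided the initial energy is sufficiently small that $$E(0)<\left(\frac{\Lambda}{2\lambda\mu}\right)^{1/\gamma}.$$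 (d) If $E(t)\to0$ as $t\to\bar t$, then as $t\to\bar t$ the mean $\int_{-1}^1 wf(w,t)\,dw$ tends to $0$ and $$\int_{-1}^1 \left( w - \int_{-1}^1 wf(w,t)\, dw\right)^2f(w,t) \, dw \to 0,$$ and the solution at $t=\bar t$ coincides with a Dirac delta concentrated in $w=0$.
   Context: No-flux boundary conditions mean that the flux $wf(1+\beta H^\alpha f^\alpha)+\lambda\,\partial_w(Hf)$ vanishes at $w=\pm1$ for all times, so the mass $\int_{-1}^1 f(w,t)\,dw=\mu$ is constant in time. $E(t)$ is called the energy (second order moment). ''Smooth solution'' means that the solution has all the integrability and differentiability properties needed in the argument. Positivity of the solution is assumed to be propagated in time.
   Formalization: Exponents corrected: 3/(2α) becomes 3α/2 in (b) and Λ, so γ=(α-2)/2 and only γ>0 is claimed; in (b) the factor C^{3α/2} is in the numerator; Ψ uses μ^α (root 1/α in (b)) and the energy per unit mass E(0)/μ. E(t̄)=0 is read as: no smooth solution past t̄, and E→0 if it lasts to t̄. *)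

(* Defs.v *)
From HB Require Import structures.
From mathcomp Require Import all_boot all_order all_algebra.
From mathcomp Require Import all_classical all_reals all_analysis.
Set Implicit Arguments.
Unset Strict Implicit.
Unset Printing Implicit Defensive.
Import Order.TTheory GRing.Theory Num.Theory.
Import numFieldNormedType.Exports.
Local Open Scope classical_set_scope.
Local Open Scope ring_scope.

Section Defs.
Context {R : realType}.
Implicit Types (al la be mu e w t T : R) (g : R -> R) (f : R -> R -> R).

Definition intI g : R := \int[lebesgue_measure]_(w in `[(-1 : R), 1]) g w.

Definition mass g : R := intI g.
Definition mean g : R := intI (fun w => w * g w).
Definition energy g : R := intI (fun w => w ^+ 2 * g w).
Definition centered_energy g : R :=
  intI (fun w => (w - mean g) ^+ 2 * g w).
(* the square of the L^2 norm *)
Definition sqL2norm g : R := intI (fun w => g w ^+ 2).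

Definition H w : R := 1 - w ^+ 2.

(* w f (1 + beta H^alpha f^alpha) + lambda (H f)_w *)
Definition flux al la be f t w : R :=
  w * f w t * (1 + be * H w `^ al * f w t `^ al)
  + la * (fun v => H v * f v t)^`()%classic w.

(* Classical nonnegative solution on [-1, 1] x [0, T).  No regularity is asked
   for beyond what the equation and the moment computations involve, so every
   solution that is C^2 on [-1, 1] x [0, T) qualifies.  A derivative in w at
   w = -1 or 1 would see values of f outside of [-1, 1]: the equation is
   therefore imposed for -1 < w < 1 and the no-flux conditions are limits. *)
Record smooth_solution al la be T (f0 : R -> R) f : Prop := SmoothSolution {
  sol_ge0 : forall w t, -1 <= w <= 1 -> 0 <= t < T -> 0 <= f w t ;
  sol_init : forall w, -1 <= w <= 1 -> f w 0 = f0 w ;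
  sol_cont : {within `[(-1 : R), 1] `*` `[0, T[,
    continuous (fun p : R * R => f p.1 p.2)} ;
  sol_derivable_t : forall w t, -1 <= w <= 1 -> 0 < t < T ->
    derivable (f w) t 1 ;
  sol_cont_dt : {within `[(-1 : R), 1] `*` `]0, T[,
    continuous (fun p : R * R => (f p.1)^`()%classic p.2)} ;
  sol_derivable_Hf : forall w t, -1 < w < 1 -> 0 < t < T ->
    derivable (fun v => H v * f v t) w 1 ;
  sol_derivable_flux : forall w t, -1 < w < 1 -> 0 < t < T ->
    derivable (flux al la be f t) w 1 ;
  sol_eq : forall w t, -1 < w < 1 -> 0 < t < T ->
    (f w)^`()%classic t = (flux al la be f t)^`()%classic w ;
  sol_noflux_left : forall t, 0 < t < T ->
    flux al la be f t w @[w --> (-1 : R)^'+] --> (0 : R) ;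
  sol_noflux_right : forall t, 0 < t < T ->
    flux al la be f t w @[w --> (1 : R)^'-] --> (0 : R)
}.

Definition c_ al : R := (2 * al / (al - 2)) `^ (al / (al + 1)).
Definition d_ al : R := (2 * (al + 1) / (c_ al * (al - 2))) `^ (3^-1).
Definition C_ al : R := c_ al * d_ al + (d_ al) ^- 2.

Definition Phi al la be mu e : R :=
  2 * la * mu
  - 2 * be / C_ al `^ (3 * al / 2)
    * ((mu - e) `^ (3 * al / 2) / e `^ ((al - 2) / 2)).

(* Here e is the energy per unit mass, so that
   Phi al la be mu (mu * e) = mu * Psi al la be mu e.  This makes mu enter with
   the exponent alpha, in accordance with the invariance of the equation under
   (f, beta) |-> (s f, s^-alpha beta). *)
Definition Psi al la be mu e : R :=
  2 * la
  - 2 * be / C_ al `^ (3 * al / 2) * mu `^ al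
    * ((1 - e) `^ (3 * al / 2) / e `^ ((al - 2) / 2)).

(* the positive zero of mu |-> Psi al la be mu e, for 0 < e < 1 *)
Definition mass_threshold al la be e : R :=
  (la * C_ al `^ (3 * al / 2) / be
   * (e `^ ((al - 2) / 2) / (1 - e) `^ (3 * al / 2))) `^ al^-1.

(* Lambda and gamma carry the exponents of Phi:
   Phi al la be mu e = 2 * la * mu - Lambda al be mu e / e `^ gamma al. *)
Definition Lambda al be mu e : R :=
  2 * be * (mu - e) `^ (3 * al / 2) / C_ al `^ (3 * al / 2).
Definition gamma al : R := (al - 2) / 2.

Definition tbar al la be mu e : R :=
  e `^ (gamma al + 1)
  / ((gamma al + 1) * (Lambda al be mu e - 2 * la * mu * e `^ gamma al)).

End Defs.

(* Main.v *)
Require Import Defs.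
From HB Require Import structures.
From mathcomp Require Import all_boot all_order all_algebra.
From mathcomp Require Import all_classical all_reals all_analysis.
From mathcomp Require Import ring lra.
Set Implicit Arguments.
Unset Strict Implicit.
Unset Printing Implicit Defensive.
Import Order.TTheory GRing.Theory Num.Theory.
Import numFieldNormedType.Exports.
Local Open Scope classical_set_scope.
Local Open Scope ring_scope.

(** The evolution in (c) is governed by one differential inequality for the
    energy, [E' <= Phi (E)] ([energy_rate_le]).  Testing the equation against
    [w^2] gives, the boundary terms being killed by the no-flux conditions
    ([energy_rate]),
      [E' = - 2 E - 2 be (int w^2 H^al f^(al+1)) + 2 la (mu - E)],
    so diffusion feeds the energy at a rate of at most [2 la mu], while the
    nonlinear drift drains it.  The drain is bounded below by an interpolation
    inequality ([mass_le_energy_weighted]): a nonnegative [g], here [H f], whose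
    second moment is small compared to its mass is concentrated near [0], and
    [int w^2 g^(al+1)] is then at least of order [mass^(3al/2) / E^gamma].

    To prove it, the mass is split at a radius [r] ([chebyshev_split]).  Outside,
    it is at most [r^-2 E].  Inside, Hoelder's inequality with the weight [w^2]
    applies ([weighted_interpolation]), and its dual weight [|w|^(-2/al)] is
    integrable at the origin exactly because [al > 2]
    ([regularized_weight_le]).  The radius is then chosen so that both parts are
    comparable; the value [d_ al >= 1] of the free constant produces [C_ al].
    With the weight [1] and the exponent [2] the same splitting bounds the energy
    below by the [L^2] norm ([mass5_le_energy_L2]).

    Since [Phi] increases with the energy, a negative initial value is kept
    forever: the energy stays below its initial value ([barrier],
    [energy_le_initial]), the factor [mu - E] above its own, and [E^(gamma+1)]
    decreases at least linearly, down to [0] at time [tbar]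
    ([energy_power_decay]).  The [L^2] bound keeps the energy of a solution
    positive, so the solution cannot live beyond [tbar] ([extinction_bound]), and
    if it lives until then, its energy tends to [0] and its [L^2] norm explodes
    ([energy_extinction], [L2_blowup]).  The conditions of smallness of the energy
    and of largeness of the mass are the same, as [Phi] at the energy [e] is [mu]
    times [Psi] at the energy per unit mass [e / mu] ([Phi_Psi]).

    For (d), a vanishing energy forces the mean to vanish by the Cauchy-Schwarz
    inequality, and the weak limit is read off the estimate
    [|phi w - phi 0| <= x + C w^2] ([quadratic_modulus]). *)

(** * Continuity on a set, powers, derivatives, integrals on a segment *)

Section WithinContinuity.
Context {R : realType} {T : topologicalType}.
Implicit Types (A : set T) (f g : T -> R).

Lemma within_cst A (c : R) : {within A, continuous (fun=> c : R)}.
Proof. by move=> x; exact: cvg_cst. Qed.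

Lemma withinD A f g : {within A, continuous f} -> {within A, continuous g} ->
  {within A, continuous (fun x => f x + g x)}.
Proof. by move=> cf cg x; apply: cvgD; [exact: cf|exact: cg]. Qed.

Lemma withinB A f g : {within A, continuous f} -> {within A, continuous g} ->
  {within A, continuous (fun x => f x - g x)}.
Proof. by move=> cf cg x; apply: cvgB; [exact: cf|exact: cg]. Qed.

Lemma withinM A f g : {within A, continuous f} -> {within A, continuous g} ->
  {within A, continuous (fun x => f x * g x)}.
Proof. by move=> cf cg x; apply: cvgM; [exact: cf|exact: cg]. Qed.

Lemma withinX A f n : {within A, continuous f} ->
  {within A, continuous (fun x => f x ^+ n)}.
Proof.
move=> cf x; apply: (@cvg_comp _ _ _ f (fun y => y ^+ n)) (cf x) _.
exact: exprn_continuous.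
Qed.

Lemma within_eq A f g : {in A, f =1 g} -> {within A, continuous f} ->
  {within A, continuous g}.
Proof. exact: subspace_eq_continuous. Qed.

End WithinContinuity.

Section Powers.
Context {R : realType}.

Lemma continuous_powR_gt0 (p x : R) : 0 < x ->
  {for x, continuous (fun y : R => y `^ p)}.
Proof.
move=> x0; apply: differentiable_continuous; apply/derivable1_diffP/derivable_powR.
by rewrite in_itv/= x0.
Qed.

(** [x `^ p] is [1] for [x < 0], hence the absolute value. *)
Lemma continuous_norm_powR (p : R) : 0 < p ->
  continuous (fun x : R => `|x| `^ p).
Proof.
move=> p0 x; have [->|x0] := eqVneq x 0.
  rewrite /continuous_at normr0 powR0 ?gt_eqF//.
  apply/cvgrPdist_lt => e e0; near=> y.
  rewrite sub0r normrN ger0_norm ?powR_ge0//.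
  have -> : e = (e `^ p^-1) `^ p by rewrite -powRrM mulVf ?gt_eqF// powRr1 ?ltW.
  rewrite gt0_ltr_powR ?nnegrE ?powR_ge0//.
  near: y; have := @nbhsx_ballx R R 0 (e `^ p^-1) (powR_gt0 _ e0).
  by apply: filterS => y; rewrite /ball/= sub0r normrN.
apply: (@cvg_comp _ _ _ (fun x : R => `|x|) (fun y => y `^ p)).
  exact: (@norm_continuous _ R).
by apply: continuous_powR_gt0; rewrite normr_gt0.
Unshelve. all: by end_near. Qed.

Lemma within_powR {T : topologicalType} (A : set T) (f : T -> R) (p : R) :
  0 < p -> (forall x, A x -> 0 <= f x) -> {within A, continuous f} ->
  {within A, continuous (fun x => f x `^ p)}.
Proof.
move=> p0 f0 cf; apply: (@within_eq _ _ _ (fun x => `|f x| `^ p)).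
  by move=> x /set_mem Ax; rewrite ger0_norm// f0.
move=> x; apply: (@cvg_comp _ _ _ f (fun y : R => `|y| `^ p)) (cf x) _.
exact: continuous_norm_powR.
Qed.

Lemma within_powR_gt0 {T : topologicalType} (A : set T) (f : T -> R) (p : R) :
  (forall x, A x -> 0 < f x) -> {within A, continuous f} ->
  {within A, continuous (fun x => f x `^ p)}.
Proof.
move=> f0 cf; rewrite continuous_subspace_in => x Ax.
apply: (@cvg_comp _ _ _ f (fun y : R => y `^ p)) (cf x) _.
by apply: continuous_powR_gt0; apply: f0; exact/set_mem.
Qed.

(** Lets a regularization parameter tend to [0]. *)
Lemma le_of_gt0 (X : R) (Y : R -> R) :
  {for 0, continuous Y} -> (forall e, 0 < e -> X <= Y e) -> X <= Y 0.
Proof.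
move=> cY XY.
have cY' : Y e @[e --> 0^'+] --> Y 0.
  by apply: cvg_at_right_filter; exact: cY.
rewrite -(cvg_lim _ cY')//; apply: limr_ge; first by apply/cvg_ex; exists (Y 0).
by near=> e; apply: XY; near: e; exact: nbhs_right_gt.
Unshelve. all: by end_near. Qed.

End Powers.

(** Derivation rules for functions given pointwise, which unification does not
    recognize as sums, products or composites of functions. *)
Section PointwiseDerivatives.
Context {R : realType}.
Implicit Types (f g : R -> R) (x p df dg : R).

Lemma is_derive_fD f g x df dg : is_derive x 1 f df -> is_derive x 1 g dg ->
  is_derive x 1 (fun y => f y + g y) (df + dg).
Proof. by move=> ? ?; exact: is_deriveD. Qed.

Lemma is_derive_fB f g x df dg : is_derive x 1 f df -> is_derive x 1 g dg ->
  is_derive x 1 (fun y => f y - g y) (df - dg).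
Proof. by move=> ? ?; exact: is_deriveB. Qed.

Lemma is_derive_fM f g x df dg : is_derive x 1 f df -> is_derive x 1 g dg ->
  is_derive x 1 (fun y => f y * g y) (f x * dg + g x * df).
Proof. by move=> ? ?; exact: is_deriveM. Qed.

Lemma is_derive_fsqr x : is_derive x 1 (fun y : R => y ^+ 2) (2 * x).
Proof. by apply: is_derive_eq (_ : x * 1 + x * 1 = _); ring. Qed.

Lemma is_derive_fpowR f x df p : 0 < f x -> is_derive x 1 f df ->
  is_derive x 1 (fun y => f y `^ p) (p * f x `^ (p - 1) * df).
Proof.
move=> fx0 dfx; have dp := is_derive1_powR p fx0.
by have := @is_derive1_comp _ (fun y : R => y `^ p) f x _ _ dp dfx.
Qed.

End PointwiseDerivatives.

Section IntegralOnSegment.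
Context {R : realType}.
Local Notation leb := (@lebesgue_measure R).
Implicit Types (a b c : R) (g h : R -> R).

Lemma segment_integrable a b g : {within `[a, b], continuous g} ->
  leb.-integrable `[a, b] (EFin \o g).
Proof.
by move=> cg; apply: continuous_compact_integrable => //; exact: segment_compact.
Qed.

(** Only the one-sided limits of the primitive matter, as for a flux, whose
    formula is meaningless at the end points. *)
Lemma Rintegral_segment_ftc g G (a b la lb : R) : a < b ->
  {within `[a, b], continuous g} ->
  (forall x, a < x < b -> is_derive x 1 G (g x)) ->
  G x @[x --> a^'+] --> la -> G x @[x --> b^'-] --> lb ->
  \int[leb]_(x in `[a, b]) g x = lb - la.
Proof.
move=> ab cg dG Ga Gb.
pose F x := if x <= a then la else if b <= x then lb else G x.
have FG x : a < x < b -> F x = G x.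
  by move=> /andP[ax xb]; rewrite /F leNgt ax/= leNgt xb.
have nFG x : a < x < b -> {near x, F =1 G}.
  move=> axb; have : x \in `]a, b[ by rewrite in_itv.
  move=> /near_in_itvoo; apply: filterS => y; rewrite in_itv/=; exact: FG.
rewrite /Rintegral (@continuous_FTC2 _ g F)//.
- by rewrite /F !lexx (leNgt b a) ab.
- split.
  + move=> x; rewrite in_itv/= => axb.
    apply: near_eq_derivable (_ : derivable G x 1); rewrite ?oner_neq0//.
      by near=> y; apply/esym; near: y; exact: nFG.
    by case: (dG _ axb).
  + have -> : F a = la by rewrite /F lexx.
    apply: cvg_trans Ga; apply: near_eq_cvg; near=> y; apply/esym/FG; apply/andP; split.
      by near: y; exact: nbhs_right_gt.
    by near: y; exact: nbhs_right_lt.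
  + have -> : F b = lb by rewrite /F leNgt ab/= lexx.
    apply: cvg_trans Gb; apply: near_eq_cvg; near=> y; apply/esym/FG; apply/andP; split.
      by near: y; exact: nbhs_left_gt.
    by near: y; exact: nbhs_left_lt.
- move=> x; rewrite in_itv/= => axb; rewrite derive1E.
  have -> : 'D_1 F x = 'D_1 G x.
    by apply: near_eq_derive; rewrite ?oner_neq0//; exact: nFG.
  by have [_ ->] := dG _ axb.
Unshelve. all: by end_near. Qed.

End IntegralOnSegment.

Section SegmentAlgebra.
Context {R : realType}.
Local Notation leb := (@lebesgue_measure R).
Implicit Types (a b c : R) (g h : R -> R).

Lemma segment_le a b g h :
  {within `[a, b], continuous g} -> {within `[a, b], continuous h} ->
  (forall x, a <= x <= b -> g x <= h x) ->
  \int[leb]_(x in `[a, b]) g x <= \int[leb]_(x in `[a, b]) h x.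
Proof.
by move=> cg ch gh; apply: le_Rintegral => //; exact: segment_integrable.
Qed.

Lemma segment_eq a b g h : (forall x, a <= x <= b -> g x = h x) ->
  \int[leb]_(x in `[a, b]) g x = \int[leb]_(x in `[a, b]) h x.
Proof.
by move=> gh; apply: eq_Rintegral => x /set_mem/=; rewrite in_itv/=; exact: gh.
Qed.

Lemma segmentD a b g h :
  {within `[a, b], continuous g} -> {within `[a, b], continuous h} ->
  \int[leb]_(x in `[a, b]) (g x + h x) =
  \int[leb]_(x in `[a, b]) g x + \int[leb]_(x in `[a, b]) h x.
Proof. by move=> cg ch; rewrite RintegralD//; exact: segment_integrable. Qed.

Lemma segmentZ a b c g : {within `[a, b], continuous g} ->
  \int[leb]_(x in `[a, b]) (c * g x) = c * \int[leb]_(x in `[a, b]) g x.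
Proof. by move=> cg; rewrite RintegralZl//; exact: segment_integrable. Qed.

Lemma segment_ge0 a b g : (forall x, a <= x <= b -> 0 <= g x) ->
  0 <= \int[leb]_(x in `[a, b]) g x.
Proof.
by move=> g0; apply: Rintegral_ge0 => x /=; rewrite in_itv/=; exact: g0.
Qed.

(** Young's inequality, integrated after normalizing both factors; upper bounds
    of the two norms are used instead of the norms so that they may be taken
    positive. *)
Lemma hoelder_segment a b (p q P W : R) (u v : R -> R) :
  0 < p -> 0 < q -> p^-1 + q^-1 = 1 ->
  {within `[a, b], continuous u} -> {within `[a, b], continuous v} ->
  (forall x, a <= x <= b -> 0 <= u x) -> (forall x, a <= x <= b -> 0 <= v x) ->
  0 < P -> 0 < W ->
  \int[leb]_(x in `[a, b]) (u x `^ p) <= P ->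
  \int[leb]_(x in `[a, b]) (v x `^ q) <= W ->
  \int[leb]_(x in `[a, b]) (u x * v x) <= P `^ p^-1 * W `^ q^-1.
Proof.
move=> p0 q0 pq cu cv u0 v0 P0 W0 uP vW.
have P'0 : 0 < P `^ p^-1 by rewrite powR_gt0.
have W'0 : 0 < W `^ q^-1 by rewrite powR_gt0.
have cup : {within `[a, b], continuous (fun x => u x `^ p)}.
  by apply: within_powR => // x /=; rewrite in_itv/=; exact: u0.
have cvq : {within `[a, b], continuous (fun x => v x `^ q)}.
  by apply: within_powR => // x /=; rewrite in_itv/=; exact: v0.
rewrite -[leRHS]mulr1 -ler_pdivrMl ?mulr_gt0//.
rewrite -segmentZ; last exact: withinM.
apply: (@le_trans _ _ (\int[leb]_(x in `[a, b])
    ((P * p)^-1 * u x `^ p + (W * q)^-1 * v x `^ q))).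
  apply: segment_le.
  - by apply: withinM; [exact: within_cst|exact: withinM].
  - by apply: withinD; apply: withinM => //; exact: within_cst.
  move=> x xab.
  have := @conjugate_powR R (u x / P `^ p^-1) (v x / W `^ q^-1) p q.
  have u1 := u0 _ xab; have v1 := v0 _ xab.
  move=> /(_ _ _ p0 q0 pq); rewrite !divr_ge0 ?(ltW P'0) ?(ltW W'0)//.
  move=> /(_ isT isT).
  rewrite (_ : u x / _ * _ = (P `^ p^-1 * W `^ q^-1)^-1 * (u x * v x)); last first.
    by rewrite invfM; ring.
  move=> /le_trans; apply.
  have powVK (z r s : R) : 0 < z -> 0 < r -> 0 <= s ->
      (s / z `^ r^-1) `^ r = s `^ r / z.
    move=> z0 r0 s0; rewrite powRM ?invr_ge0 ?powR_ge0//; congr (_ * _).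
    by rewrite -powRN -powRrM mulNr mulVf ?gt_eqF// powR_inv1 ?ltW.
  by rewrite !powVK// lerD// invfM; lra.
rewrite segmentD; try by apply: withinM => //; exact: within_cst.
rewrite !segmentZ// -pq lerD// mulrC ler_pdivrMr ?mulr_gt0//.
  by rewrite mulrCA mulVf ?mulr1 ?gt_eqF.
by rewrite mulrCA mulVf ?mulr1 ?gt_eqF.
Qed.

End SegmentAlgebra.

(** * Interpolation between mass, second moment and a weighted norm *)

Section Interpolation.
Context {R : realType}.
Local Notation leb := (@lebesgue_measure R).
Local Notation I := `[(-1 : R), 1]%classic.
Implicit Types (g h k : R -> R).

Lemma within_id (A : set R) : {within A, continuous (fun w : R => w)}.
Proof. by apply: continuous_subspaceT => x; exact: cvg_id. Qed.

Lemma within_sqr (A : set R) : {within A, continuous (fun w : R => w ^+ 2)}.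
Proof. exact/withinX/within_id. Qed.

(** Outside of [[-r, r]], [g <= r^-2 w^2 g].  The minimum with [1] keeps the inner
    segment inside [[-1, 1]]. *)
Lemma chebyshev_split g (r : R) :
  {within I, continuous g} -> (forall w, -1 <= w <= 1 -> 0 <= g w) -> 0 < r ->
  intI g <= \int[leb]_(w in `[- Num.min r 1, Num.min r 1]) g w
            + r ^- 2 * intI (fun w => w ^+ 2 * g w).
Proof.
move=> cg g0 r0; set rho := Num.min r 1; set A : set R := `[- rho, rho]%classic.
have rho1 : rho <= 1 by rewrite ge_min lexx orbT.
have AI : A `<=` I.
  by apply: subset_itv; rewrite bnd_simp; lra.
have cwg : {within I, continuous (fun w => w ^+ 2 * g w)}.
  by apply: withinM => //; exact: within_sqr.
have igA : leb.-integrable I (EFin \o (g \_ A)).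
  rewrite -restrict_EFin; apply/integrable_restrict => //=; first exact: measurable_itv.
  by rewrite setIidr//; exact/segment_integrable/(continuous_subspaceW AI).
have AE : \int[leb]_(w in A) g w = \int[leb]_(w in I) (g \_ A) w.
  by rewrite -Rintegral_mkcondr setIidr.
have cr : {within I, continuous (fun w => r ^- 2 * (w ^+ 2 * g w))}.
  by apply: withinM => //; exact: within_cst.
rewrite AE /intI -segmentZ// -RintegralD//; last exact: segment_integrable.
apply: le_Rintegral => //; first exact: segment_integrable.
  rewrite (_ : _ \o _ = ((EFin \o (g \_ A)) \+
     (EFin \o (fun w => r ^- 2 * (w ^+ 2 * g w))%R))%E); last exact/funext.
  by apply: integrableD => //; exact: segment_integrable.
move=> w wI; have gw : 0 <= g w by apply: g0; move: wI; rewrite /= in_itv.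
rewrite patchE; case: ifPn => [_|/negP wA].
  by rewrite lerDl mulr_ge0 ?invr_ge0 ?sqr_ge0// mulr_ge0 ?sqr_ge0.
rewrite add0r mulrA -[leLHS]mul1r ler_wpM2r// mulrC ler_pdivlMr ?exprn_gt0//.
rewrite mul1r -(ger0_norm (ltW r0)) -real_normK ?num_real//.
rewrite -[leRHS]real_normK ?num_real//.
rewrite ger0_norm// lerXn2r// ?nnegrE//.
have : rho < `|w|.
  rewrite ltNge; apply/negP => h; apply: wA; apply/mem_set.
  by rewrite /A/= in_itv/= -ler_norml.
have : `|w| <= 1 by move: wI; rewrite /= in_itv/= ler_norml.
rewrite (ger0_norm (ltW r0)).
by rewrite /rho; case: (leP r 1) => [|] *; lra.
Qed.

(** Hoelder's inequality for [g = (k^(1/p) g) k^(-1/p)] on the inner segment. *)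
Lemma weighted_interpolation g k (p q s P W r : R) :
  0 < p -> 0 < q -> p^-1 + q^-1 = 1 -> 0 <= s -> 0 < P -> 0 < W -> 0 < r ->
  {within I, continuous g} -> (forall w, -1 <= w <= 1 -> 0 <= g w) ->
  {within I, continuous k} -> (forall w, -1 <= w <= 1 -> 0 < k w) ->
  intI (fun w => k w * g w `^ p) <= P ->
  (forall rho, 0 < rho <= 1 ->
    \int[leb]_(w in `[- rho, rho]) (k w `^ (- (q / p))) <= W * rho `^ s) ->
  intI g <= P `^ p^-1 * (W * r `^ s) `^ q^-1
            + r ^- 2 * intI (fun w => w ^+ 2 * g w).
Proof.
move=> p0 q0 pq s0 P0 W0 r0 cg g0 ck k0 kP kW.
apply: (le_trans (chebyshev_split cg g0 r0)); rewrite lerD2r.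
set rho := Num.min r 1.
have rho0 : 0 < rho by rewrite lt_min r0 ltr01.
have rho1 : rho <= 1 by rewrite ge_min lexx orbT.
have sub w : - rho <= w <= rho -> -1 <= w <= 1.
  by move=> /andP[? ?]; apply/andP; split; lra.
have AI : `[- rho, rho]%classic `<=` I by exact: sub.
have cgA := continuous_subspaceW AI cg.
have ckA := continuous_subspaceW AI ck.
have kA0 w : `[- rho, rho]%classic w -> 0 < k w.
  by rewrite /= in_itv/= => /sub/k0.
have gA0 w : `[- rho, rho]%classic w -> 0 <= g w.
  by rewrite /= in_itv/= => /sub/g0.
have ckp := within_powR_gt0 (p := p^-1) kA0 ckA.
have ckn := within_powR_gt0 (p := - p^-1) kA0 ckA.
have gE w : - rho <= w <= rho -> g w = (k w `^ p^-1 * g w) * k w `^ (- p^-1).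
  move=> /sub/k0 kw; rewrite mulrAC -powRD ?subrr ?powRr0 ?mul1r//.
  by rewrite (gt_eqF kw)/= implybT.
rewrite (segment_eq gE).
apply: hoelder_segment => //.
- exact: withinM.
- by move=> w /sub wI; rewrite mulr_ge0 ?powR_ge0// g0.
- by move=> *; exact: powR_ge0.
- by rewrite mulr_gt0// powR_gt0.
- apply: le_trans kP.
  have kgE w : -1 <= w <= 1 -> (k w `^ p^-1 * g w) `^ p = k w * g w `^ p.
    move=> wI; rewrite powRM ?powR_ge0 ?g0// -powRrM mulVf ?gt_eqF//.
    by rewrite powRr1// ltW// k0.
  rewrite (segment_eq (h := fun w => k w * g w `^ p)); last first.
    by move=> w /sub; exact: kgE.
  have ckg : {within I, continuous (fun w => k w * g w `^ p)}.
    apply: withinM => //; apply: within_powR => // w; rewrite /= in_itv/=; exact: g0.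
  rewrite /Rintegral fine_le//.
  + apply: integrable_fin_num => //; apply: segment_integrable.
    exact: continuous_subspaceW ckg.
  + by apply: integrable_fin_num => //; exact: segment_integrable.
  + apply: ge0_subset_integral => //.
      by apply: measurable_int (segment_integrable ckg).
    move=> w; rewrite /= in_itv/= => wI.
    by rewrite lee_fin mulr_ge0 ?powR_ge0// ltW// k0.
- under eq_Rintegral do rewrite -powRrM mulNr mulrC.
  apply: (@le_trans _ _ (W * rho `^ s)); first by apply: kW; rewrite rho0.
  rewrite ler_pM2l// ge0_ler_powR ?nnegrE ?(ltW rho0) ?(ltW r0)//.
  by rewrite ge_min lexx.
Qed.

End Interpolation.

(** * Lower bound of the energy by the L2 norm *)

Section L2Bound.
Context {R : realType}.
Local Notation leb := (@lebesgue_measure R).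
Local Notation I := `[(-1 : R), 1]%classic.
Implicit Types (g : R -> R).

Lemma segment_cst (rho c : R) : 0 <= rho ->
  \int[leb]_(w in `[- rho, rho]) c = c * (2 * rho).
Proof.
move=> rho0; rewrite Rintegral_cst//= lebesgue_measure_itv/= lte_fin.
case: ltP => [_|h]; first by rewrite -EFinD/= opprK; congr (_ * _); ring.
by rewrite (_ : rho = 0) ?mulr0//; lra.
Qed.

Lemma powR_invnK n (y : R) : 0 <= y -> (0 < n)%N -> (y `^ n%:R^-1) ^+ n = y.
Proof.
move=> y0 n0; rewrite -powR_mulrn ?powR_ge0// -powRrM mulVf ?powRr1//.
by rewrite pnatr_eq0 -lt0n.
Qed.

(** The case [k = 1], [p = 2] of [weighted_interpolation], at the optimal radius. *)
Lemma mass_le_energy_L2 g (E P : R) : 0 < E -> 0 < P ->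
  {within I, continuous g} -> (forall w, -1 <= w <= 1 -> 0 <= g w) ->
  energy g <= E -> sqL2norm g <= P ->
  64 * mass g ^+ 5 <= 5 ^+ 5 * E * P ^+ 2.
Proof.
move=> E0 P0 cg g0 gE gP.
have EP0 : 0 < 8 * E ^+ 2 / P by rewrite divr_gt0 ?mulr_gt0 ?exprn_gt0.
(* minimizes sqrt (2 r P) + E / r^2 *)
have [r r0 r5] : exists2 r, 0 < r & r ^+ 5 * P = 8 * E ^+ 2.
  exists ((8 * E ^+ 2 / P) `^ 5%:R^-1); first exact: powR_gt0.
  by rewrite powR_invnK ?(ltW EP0)// divfK ?gt_eqF.
(* x is sqrt (2 r P), in the form in which the interpolation yields it *)
pose x := P `^ 2^-1 * (2 * r `^ 1) `^ 2^-1.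
have x0 : 0 <= x by rewrite mulr_ge0 ?powR_ge0.
have x2 : x ^+ 2 = 2 * r * P.
  rewrite exprMn !powR_invnK ?(ltW P0) ?mulr_ge0 ?powR_ge0// powRr1 ?(ltW r0)//.
  by rewrite mulrC.
have xr2 : x * r ^+ 2 = 4 * E.
  have xr0 : 0 <= x * r ^+ 2 by rewrite mulr_ge0 ?sqr_ge0.
  have E40 : 0 <= 4 * E by rewrite mulr_ge0 ?(ltW E0).
  apply/eqP; rewrite -(@eqrXn2 _ 2)//; apply/eqP.
  rewrite exprMn x2 -exprM exprMn.
  have -> : 2 * r * P * r ^+ (2 * 2) = 2 * (r ^+ 5 * P) by rewrite /=; ring.
  by rewrite r5; ring.
have m0 : 0 <= mass g by apply: Rintegral_ge0 => w /=; rewrite in_itv/=; exact: g0.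
have mx : mass g <= x + r ^- 2 * E.
  apply: (@le_trans _ _ (x + r ^- 2 * energy g)); last first.
    by rewrite lerD2l ler_wpM2l// invr_ge0 sqr_ge0.
  apply: (@weighted_interpolation R g (fun=> 1) 2 2 1 P 2 r) => //.
  - by field.
  - exact: within_cst.
  - rewrite /intI (segment_eq (h := fun w => g w ^+ 2)) => // w wI.
    by rewrite mul1r powR_mulrn ?g0.
  - move=> rho /andP[rho0 _]; under eq_Rintegral do rewrite powR1.
    by rewrite segment_cst ?(ltW rho0)// mul1r powRr1 ?(ltW rho0).
have {}mx : mass g <= 5 / 4 * x.
  apply: (le_trans mx); rewrite (_ : r ^- 2 * E = x / 4); first by lra.
  have -> : E = x * r ^+ 2 / 4 by rewrite xr2; field.
  by field; rewrite gt_eqF.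
have : mass g ^+ 5 <= (5 / 4 * x) ^+ 5 by rewrite lerXn2r// nnegrE// mulr_ge0.
have -> : (5 / 4 * x) ^+ 5 = 5 ^+ 5 / 4 ^+ 5 * (x * (x ^+ 2) ^+ 2) by field.
rewrite x2 (_ : x * _ = 4 * P ^+ 2 * (x * r ^+ 2)); last by ring.
by rewrite xr2; lra.
Qed.

(** In product form the bound remains meaningful when the [L^2] norm vanishes, and
    then says that the mass vanishes. *)
Lemma mass5_le_energy_L2 g :
  {within I, continuous g} -> (forall w, -1 <= w <= 1 -> 0 <= g w) ->
  64 * mass g ^+ 5 <= 5 ^+ 5 * energy g * sqL2norm g ^+ 2.
Proof.
move=> cg g0.
have e0 : 0 <= energy g.
  by apply: segment_ge0 => w wI; rewrite mulr_ge0 ?sqr_ge0 ?g0.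
have s0 : 0 <= sqL2norm g by apply: segment_ge0 => w wI; rewrite sqr_ge0.
pose Y e := 5 ^+ 5 * (energy g + e) * (sqL2norm g + e) ^+ 2.
have -> : 5 ^+ 5 * energy g * sqL2norm g ^+ 2 = Y 0 by rewrite /Y !addr0.
apply: le_of_gt0 => [|e e0'].
  rewrite /Y; apply: cvgM.
    by apply: cvgM; [exact: cvg_cst|apply: cvgD; [exact: cvg_cst|exact: cvg_id]].
  apply: (@cvg_comp _ _ _ (fun e => sqL2norm g + e) (fun x => x ^+ 2)).
    by apply: cvgD; [exact: cvg_cst|exact: cvg_id].
  exact: exprn_continuous.
by apply: mass_le_energy_L2 => //; rewrite ?lerDl ?ltW// ltr_wpDl.
Qed.

End L2Bound.

(** * The weighted interpolation inequality *)

Section WeightedBound.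
Context {R : realType}.
Local Notation leb := (@lebesgue_measure R).
Local Notation I := `[(-1 : R), 1]%classic.
Variable al : R.
Hypothesis al_gt2 : 2 < al.

Let al0 : 0 < al. Proof. exact: lt_trans al_gt2. Qed.
Let alm2 : 0 < al - 2. Proof. by rewrite subr_gt0. Qed.

Lemma c_gt0 : 0 < c_ al.
Proof. by rewrite powR_gt0// divr_gt0// mulr_gt0. Qed.

Lemma d_ge1 : 1 <= d_ al.
Proof.
rewrite [leLHS](_ : 1 = 1 `^ 3^-1); last by rewrite powR1.
have cle : c_ al <= 2 * al / (al - 2).
  apply: ler1_powR; first by rewrite ler_pdivlMr// mul1r; move: al_gt2; lra.
  by rewrite ler_pdivrMr ?mul1r ?addr_gt0// lerDl.
have c1 : 1 <= 2 * (al + 1) / (c_ al * (al - 2)).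
  rewrite ler_pdivlMr ?mulr_gt0 ?c_gt0// mul1r.
  by move: cle; rewrite ler_pdivlMr//; lra.
by rewrite ge0_ler_powR ?nnegrE ?invr_ge0//; lra.
Qed.

Lemma C_gt0 : 0 < C_ al.
Proof.
have d0 := lt_le_trans ltr01 d_ge1.
by rewrite addr_gt0 ?mulr_gt0 ?c_gt0// invr_gt0 exprn_gt0.
Qed.

(** The integral of [|w|^(-2/al)] over [[-rho, rho]] is the right-hand side.
    The regularized weight is dominated by a multiple of the derivative of
    [w (w^2 + del^2)^(-1/al)], which spares the singularity at the origin. *)
Lemma regularized_weight_le (del rho : R) : 0 < del -> 0 < rho ->
  \int[leb]_(w in `[- rho, rho]) ((w ^+ 2 + del ^+ 2) `^ (- al^-1))
  <= 2 * al / (al - 2) * rho `^ ((al - 2) / al).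
Proof.
move=> del0 rho0.
pose k (w : R) := w ^+ 2 + del ^+ 2.
have k0 w : 0 < k w by rewrite ltr_wpDl ?sqr_ge0 ?exprn_gt0.
(* psi' = k^(-1/al) (1 - (2/al) w^2/k) >= (1 - 2/al) k^(-1/al) *)
pose psi w := w * k w `^ (- al^-1).
pose dpsi w := k w `^ (- al^-1) - 2 / al * w ^+ 2 * k w `^ (- al^-1 - 1).
have ck A : {within A, continuous k}.
  by apply: withinD; [exact: within_sqr|exact: within_cst].
have ckp A p : {within A, continuous (fun w => k w `^ p)}.
  by apply: within_powR_gt0 => // w _; exact: k0.
have cdpsi A : {within A, continuous dpsi}.
  apply: withinB; first exact: ckp.
  apply: withinM; last exact: ckp.
  by apply: withinM; [exact: within_cst|exact: within_sqr].
have dk (w : R) : is_derive w 1 k (2 * w).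
  by rewrite -[2 * w]addr0; apply: is_derive_fD; exact: is_derive_fsqr.
have dpsiE (w : R) : is_derive w 1 psi (dpsi w).
  have := is_derive_fM (is_derive_id w 1) (is_derive_fpowR (- al^-1) (k0 w) (dk w)).
  by move=> /is_derive_eq; apply; rewrite /dpsi; ring.
have cpsi (x : R) : psi w @[w --> x] --> psi x.
  by apply: differentiable_continuous; apply/derivable1_diffP; case: (dpsiE x).
have Ipsi : \int[leb]_(w in `[- rho, rho]) dpsi w = 2 * rho * k rho `^ (- al^-1).
  rewrite (@Rintegral_segment_ftc R dpsi psi _ _ (psi (- rho)) (psi rho)) //.
  - by rewrite /psi /k sqrrN; ring.
  - by lra.
  - exact: cvg_at_right_filter.
  - exact: cvg_at_left_filter.
have kdpsi w : k w `^ (- al^-1) <= al / (al - 2) * dpsi w.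
  rewrite /dpsi.
  have -> : k w `^ (- al^-1) = k w * k w `^ (- al^-1 - 1).
    rewrite powRD; last by rewrite (gt_eqF (k0 w))/= implybT.
    by rewrite powR_inv1 ?(ltW (k0 w))// mulrCA divff ?mulr1// gt_eqF.
  have : w ^+ 2 <= k w by rewrite lerDl sqr_ge0.
  have kp := powR_gt0 (- al^-1 - 1) (k0 w).
  move=> wk; rewrite -mulrBl mulrA ler_pM2r//.
  rewrite mulrC mulrA ler_pdivlMr// mulrBl.
  by rewrite mulrAC divfK ?gt_eqF//; nra.
apply: (@le_trans _ _ (\int[leb]_(w in `[- rho, rho]) (al / (al - 2) * dpsi w))).
  apply: segment_le; first exact: ckp; last by move=> w _; exact: kdpsi.
  by apply: withinM; [exact: within_cst|exact: cdpsi].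
rewrite segmentZ; last exact: cdpsi.
rewrite Ipsi.
have -> : (al - 2) / al = 1 - 2 * al^-1 by field; rewrite gt_eqF.
rewrite powRD; last by rewrite (gt_eqF rho0)/= implybT.
rewrite powRr1 ?(ltW rho0)//.
have -> : rho `^ (- (2 * al^-1)) = (rho ^+ 2) `^ (- al^-1).
  by rewrite -powR_mulrn ?(ltW rho0)// -powRrM mulrN.
have kr : k rho `^ (- al^-1) <= (rho ^+ 2) `^ (- al^-1).
  rewrite !powRN lef_pV2 ?posrE ?powR_gt0 ?exprn_gt0//.
  rewrite ge0_ler_powR ?nnegrE ?invr_ge0 ?sqr_ge0 ?(ltW al0) ?(ltW (k0 _))//.
  by rewrite lerDl sqr_ge0.
have -> : 2 * al / (al - 2) * (rho * (rho ^+ 2) `^ (- al^-1)) =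
   al / (al - 2) * (2 * rho) * (rho ^+ 2) `^ (- al^-1) by ring.
by rewrite mulrA ler_pM2l// mulr_gt0 ?divr_gt0 ?mulr_gt0.
Qed.

Let al1 : 0 < al + 1. Proof. exact: addr_gt0. Qed.

(** Balances the two terms of [weighted_interpolation], up to a constant factor
    in the radius. *)
Lemma balancing_radius (E P : R) : 0 < E -> 0 < P ->
  exists2 t, 0 < t &
    P `^ (al + 1)^-1 * t `^ ((al - 2) / (al + 1)) = E * t ^- 2 /\
    (E * t ^- 2) `^ (3 * al / 2) = E `^ ((al - 2) / 2) * P.
Proof.
move=> E0 P0; pose x := ln E; pose y := ln P.
(* powers of positive numbers become linear expressions in x and y *)
have -> : E = expR x by rewrite lnK ?posrE.
have -> : P = expR y by rewrite lnK ?posrE.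
exists (expR ((x - y / (al + 1)) * ((al + 1) / (3 * al)))); first exact: expR_gt0.
have a1 : al + 1 != 0 by rewrite gt_eqF.
have a0 : al != 0 by rewrite gt_eqF.
have eX (z : R) : expR z ^- 2 = expR (- (2 * z)).
  by rewrite expRN; congr (_^-1); rewrite -expRM_natl.
split.
  by rewrite eX -!expRM -!expRD; congr expR; field; rewrite a0 a1.
by rewrite eX -expRD -!expRM -!expRD; congr expR; field; rewrite a0 a1.
Qed.

(** At the radius [d_ al * t] the two terms are multiples of [E t^-2], with the
    factors [c_ al * d_ al `^ a] and [d_ al ^- 2]; as [a <= 1 <= d_ al], their sum
    is at most [C_ al]. *)
Lemma mass_le_weighted (g : R -> R) (E P del : R) : 0 < E -> 0 < P -> 0 < del ->
  {within I, continuous g} -> (forall w, -1 <= w <= 1 -> 0 <= g w) ->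
  energy g <= E ->
  intI (fun w => (w ^+ 2 + del ^+ 2) * g w `^ (al + 1)) <= P ->
  mass g `^ (3 * al / 2) <= C_ al `^ (3 * al / 2) * E `^ ((al - 2) / 2) * P.
Proof.
move=> E0 P0 del0 cg g0 gE gP.
have [t t0 [tQ tE]] := balancing_radius E0 P0.
have d0 : 0 < d_ al by apply: lt_le_trans d_ge1.
have m0 : 0 <= mass g by apply: segment_ge0 => w; exact: g0.
have W0 : 0 < 2 * al / (al - 2) by rewrite divr_gt0// mulr_gt0.
have dt0 : 0 < d_ al * t by rewrite mulr_gt0.
set a := (al - 2) / (al + 1) in tQ *.
have a0 : 0 <= a by rewrite divr_ge0// ltW.
have a1 : a <= 1 by rewrite /a ler_pdivrMr// mul1r; lra.
have mE : mass g <= P `^ (al + 1)^-1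
    * (2 * al / (al - 2) * (d_ al * t) `^ ((al - 2) / al)) `^ ((al + 1) / al)^-1
    + (d_ al * t) ^- 2 * E.
  apply: (@le_trans _ _ (P `^ (al + 1)^-1
    * (2 * al / (al - 2) * (d_ al * t) `^ ((al - 2) / al)) `^ ((al + 1) / al)^-1
    + (d_ al * t) ^- 2 * energy g)); last first.
    by rewrite lerD2l ler_wpM2l// invr_ge0 sqr_ge0.
  apply: (@weighted_interpolation R g (fun w => w ^+ 2 + del ^+ 2)) => //.
  - by rewrite divr_gt0.
  - by field; rewrite !gt_eqF.
  - by rewrite divr_ge0// ltW.
  - by apply: withinD; [exact: within_sqr|exact: within_cst].
  - by move=> w _; rewrite ltr_wpDl ?sqr_ge0 ?exprn_gt0.
  - move=> rho /andP[rho0 _].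
    rewrite (_ : (al + 1) / al / (al + 1) = al^-1); last by field; rewrite !gt_eqF.
    exact: regularized_weight_le.
have {}mE : mass g <= C_ al * (E * t ^- 2).
  apply: (le_trans mE).
  rewrite powRM ?powR_ge0 ?(ltW W0)// invf_div -/(c_ al) -powRrM.
  rewrite (_ : (al - 2) / al * (al / (al + 1)) = a); last first.
    by rewrite /a; field; rewrite !gt_eqF.
  rewrite powRM ?(ltW t0) ?(ltW d0)//.
  have -> : P `^ (al + 1)^-1 * (c_ al * (d_ al `^ a * t `^ a)) =
     c_ al * d_ al `^ a * (E * t ^- 2) by rewrite -tQ; ring.
  have -> : (d_ al * t) ^- 2 * E = d_ al ^- 2 * (E * t ^- 2).
    by rewrite exprMn invfM; ring.
  rewrite -mulrDl ler_pM2r ?mulr_gt0 ?invr_gt0 ?exprn_gt0//.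
  rewrite lerD2r ler_pM2l ?c_gt0//.
  by apply: ler1_powR => //; exact: d_ge1.
rewrite -[leRHS]mulrA -tE -powRM ?(ltW C_gt0) //; last first.
  by rewrite mulr_ge0 ?invr_ge0 ?sqr_ge0// ltW.
rewrite ge0_ler_powR ?nnegrE//.
  by rewrite divr_ge0// mulr_ge0// ltW.
exact: le_trans mE.
Qed.

(** The limit [del -> 0] of [mass_le_weighted].  Both sides scale alike when [g] is
    dilated or multiplied by a constant. *)
Lemma mass_le_energy_weighted (g : R -> R) (E : R) : 0 < E ->
  {within I, continuous g} -> (forall w, -1 <= w <= 1 -> 0 <= g w) ->
  energy g <= E ->
  mass g `^ (3 * al / 2) <= C_ al `^ (3 * al / 2) * E `^ ((al - 2) / 2)
    * intI (fun w => w ^+ 2 * g w `^ (al + 1)).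
Proof.
move=> E0 cg g0 gE.
set K := C_ al `^ _ * _; set P := intI _.
have cgp : {within I, continuous (fun w => g w `^ (al + 1))}.
  by apply: within_powR.
have cwgp : {within I, continuous (fun w => w ^+ 2 * g w `^ (al + 1))}.
  by apply: withinM => //; exact: within_sqr.
set G := intI (fun w => g w `^ (al + 1)).
have P0 : 0 <= P by apply: segment_ge0 => w _; rewrite mulr_ge0 ?sqr_ge0 ?powR_ge0.
have G0 : 0 <= G by apply: segment_ge0 => w _; rewrite powR_ge0.
(* G + 1 instead of G keeps the bound positive when g vanishes *)
pose Y del := K * (P + del ^+ 2 * (G + 1)).
have -> : K * P = Y 0 by rewrite /Y expr0n mul0r addr0.
apply: le_of_gt0 => [|del del0].
  apply: cvgM; first exact: cvg_cst.
  apply: cvgD; first exact: cvg_cst.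
  by apply: cvgM; [exact: exprn_continuous|exact: cvg_cst].
apply: (@mass_le_weighted _ E _ del) => //.
  by rewrite ltr_wpDl// mulr_gt0 ?exprn_gt0// ltr_wpDl.
have -> : intI (fun w => (w ^+ 2 + del ^+ 2) * g w `^ (al + 1)) = P + del ^+ 2 * G.
  rewrite /P /G /intI -segmentZ// -segmentD//; last first.
    by apply: withinM => //; exact: within_cst.
  by apply: segment_eq => w _; rewrite mulrDl.
by rewrite lerD2l ler_wpM2l ?sqr_ge0// lerDl.
Qed.

End WeightedBound.

(** * Continuity and differentiation in time of moments *)

Section Slices.
Context {R : realType}.
Implicit Types (A B : set R) (F : R * R -> R).

Lemma within_slice_left A B F t : {within A `*` B, continuous F} -> B t ->
  {within A, continuous (fun w => F (w, t))}.
Proof.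
move=> /subspace_continuousP cF Bt; apply/subspace_continuousP => x Ax.
apply: cvg_trans (cF (x, t) (conj Ax Bt)) => U /= [[P Q] [/= nP nQ] PQU].
apply: filterS nP => w Pw Aw; apply: (PQU (w, t)) => //.
by split => //=; exact: nbhs_singleton.
Qed.

Lemma within_slice_right A B F w : {within A `*` B, continuous F} -> A w ->
  {within B, continuous (fun t => F (w, t))}.
Proof.
move=> /subspace_continuousP cF Aw; apply/subspace_continuousP => x Bx.
apply: cvg_trans (cF (w, x) (conj Aw Bx)) => U /= [[P Q] [/= nP nQ] PQU].
apply: filterS nQ => t Qt Bt; apply: (PQU (w, t)) => //.
by split => //=; exact: nbhs_singleton.
Qed.

Lemma within_compact_bounded {U : topologicalType} (K : set U) (F : U -> R) :
  compact K -> {within K, continuous F} ->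
  exists2 M, 0 <= M & forall x, K x -> `|F x| <= M.
Proof.
move=> cK cF.
have /compact_bounded[M [_ MF]] := continuous_compact cF cK.
exists (Num.max M 0 + 1); first by rewrite addr_ge0 ?le_max ?lexx ?orbT.
move=> x Kx; apply: MF; last by exists x.
by rewrite (@le_lt_trans _ _ (Num.max M 0)) ?ltrDl// le_max lexx.
Qed.

Lemma compact_rectangle (a b c d : R) : compact (`[a, b] `*` `[c, d]).
Proof. by apply: compact_setX; exact: segment_compact. Qed.

Lemma within_comp_continuous_at A (h : R -> R) (u : R -> R) (a : R) :
  {within A, continuous h} -> {for a, continuous u} ->
  (\forall t \near a, A (u t)) -> {for a, continuous (fun t => h (u t))}.
Proof.
move=> /subspace_continuousP ch cu Au.
apply: cvg_comp (ch (u a) (nbhs_singleton Au)).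
move=> U /= hU; have := cu _ hU; rewrite !nbhs_simpl/= => uU.
by apply: filterS2 Au uU => t At; exact.
Qed.

End Slices.

Section Moments.
Context {R : realType}.
Local Notation leb := (@lebesgue_measure R).
Local Notation I := `[(-1 : R), 1]%classic.
Variables (al la be T : R) (f0 : R -> R) (f : R -> R -> R).
Hypothesis sol : smooth_solution al la be T f0 f.
Variable phi : R -> R.
Hypothesis cphi : {within I, continuous phi}.

Lemma sol_cont_w t : 0 <= t < T -> {within I, continuous (f ^~ t)}.
Proof.
move=> tT; apply: within_slice_left (sol_cont sol) _.
by rewrite /= in_itv.
Qed.

Lemma sol_cont_dt_w t : 0 < t < T ->
  {within I, continuous (fun w => (f w)^`()%classic t)}.
Proof.
move=> tT; apply: within_slice_left (sol_cont_dt sol) _.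
by rewrite /= in_itv.
Qed.

Let phi_bounded : exists2 K, 0 <= K & forall w, I w -> `|phi w| <= K.
Proof. by apply: within_compact_bounded => //; exact: segment_compact. Qed.

(** Dominated convergence in an open interval around the given time; the clamp
    [max t 0] provides one around [0]. *)
Lemma moment_continuous :
  {within `[0, T[, continuous (fun t => intI (fun w => phi w * f w t))}.
Proof.
have [K K0 phiK] := phi_bounded.
apply/subspace_continuousP => t0; rewrite /= in_itv/= => /andP[t00 t0T].
pose t1 := (t0 + T) / 2.
have t01 : t0 < t1 by rewrite /t1; lra.
have t1T : t1 < T by rewrite /t1; lra.
have cf1 : {within I `*` `[0, t1], continuous (fun p : R * R => f p.1 p.2)}.
  apply: continuous_subspaceW (sol_cont sol) => -[w t] [/= Iw tt].
  split=> //=; apply: subset_itv tt; by rewrite bnd_simp.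
have [M M0 fM] := within_compact_bounded (@compact_rectangle R _ _ _ _) cf1.
pose G (t w : R) := phi w * f w (Num.max t 0).
have maxP t : t < t1 -> 0 <= Num.max t 0 < T.
  by move=> tt1; rewrite le_max lexx orbT/= gt_max (lt_trans tt1)//; lra.
have cG : {in `](-1), t1[%classic, continuous (fun t => \int[leb]_(w in I) G t w)}.
  apply: (@continuity_under_integral R _ _ leb G I _ (-1) t1 _ _ (cst (K * M))) => //.
  - move=> t; rewrite /= in_itv/= => /andP[_ tt1].
    by apply: segment_integrable; apply: withinM => //; apply: sol_cont_w; exact: maxP.
  - apply: aeW => w Iw t; rewrite inE/= in_itv/= => /andP[_ tt1].
    apply: cvgM; first exact: cvg_cst.
    apply: (@within_comp_continuous_at R `[0, T[%classic (f w) (fun t => Num.max t 0)).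
    + exact: (within_slice_right (sol_cont sol) Iw).
    + by apply: continuous_max; [exact: cvg_id|exact: cvg_cst].
    + near=> s; rewrite /= in_itv/=; apply: maxP; near: s.
      exact: lt_nbhsl.
  - by apply: segment_integrable; exact: within_cst.
  - move=> t; rewrite /= in_itv/= => /andP[_ tt1]; apply: aeW => w Iw.
    rewrite normrM ler_pM//; first exact: phiK.
    apply: (fM (w, _)); split => //=; rewrite in_itv/= le_max lexx orbT/=.
    rewrite ge_max (ltW tt1).
    by rewrite (le_trans t00) ?ltW.
have t0I : t0 \in `](-1), t1[%classic by rewrite inE/= in_itv/= t01 andbT; lra.
have GE s : 0 <= s -> \int[leb]_(w in I) G s w = intI (fun w => phi w * f w s).
  by move=> s0; apply: segment_eq => w _; rewrite /G max_l.
suff : intI (fun w => phi w * f w s) @[s --> within `[0, T[%classic (nbhs t0)]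
    --> intI (fun w => phi w * f w t0) by [].
have cG0 : \int[leb]_(w in I) G s w @[s --> within `[0, T[%classic (nbhs t0)]
    --> \int[leb]_(w in I) G t0 w.
  by apply: cvg_within_filter; exact: cG.
rewrite -(GE t0 t00); apply: cvg_trans cG0.
apply: near_eq_cvg; rewrite near_withinE; apply: nearW => s /andP[s0 _].
by rewrite (GE s s0).
Unshelve. all: by end_near. Qed.

Lemma moment_is_derive t : 0 < t < T ->
  is_derive t 1 (fun s => intI (fun w => phi w * f w s))
    (intI (fun w => phi w * (f w)^`()%classic t)).
Proof.
move=> /andP[t0 tT]; have [K K0 phiK] := phi_bounded.
pose u := t / 2; pose v := (t + T) / 2.
have [u0 ut tv vT] : [/\ 0 < u, u < t, t < v & v < T].
  by rewrite /u /v; split; lra.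
have uvT s : u <= s <= v -> 0 < s < T.
  by move=> /andP[? ?]; apply/andP; split; lra.
have cf1 : {within I `*` `[u, v],
    continuous (fun p : R * R => (f p.1)^`()%classic p.2)}.
  apply: continuous_subspaceW (sol_cont_dt sol) => -[w s] [/= Iw ss].
  split=> //=; apply: subset_itv ss; by rewrite bnd_simp.
have [M M0 fM] := within_compact_bounded (@compact_rectangle R _ _ _ _) cf1.
pose G (s w : R) := phi w * f w s.
have dG s w : I w -> u < s < v -> is_derive s 1 (G ^~ w) (phi w * (f w)^`()%classic s).
  move=> Iw /andP[us sv].
  have df : is_derive s 1 (f w) ((f w)^`()%classic s).
    rewrite derive1E; apply/derivableP; apply: (sol_derivable_t sol) => //.
    by apply: uvT; rewrite !ltW.
  have := is_derive_fM (is_derive_cst (phi w) s 1) df.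
  move=> /is_derive_eq; apply.
  by rewrite mulr0 addr0.
have intG s : `]u, v[%classic s -> leb.-integrable I (EFin \o G s).
  rewrite /= in_itv/= => /andP[us sv]; apply: segment_integrable.
  apply: withinM => //; apply: sol_cont_w.
  by rewrite (lt_trans sv)// andbT ltW// (lt_trans u0).
have derG s w : `]u, v[%classic s -> I w -> derivable (G ^~ w) s 1.
  by rewrite /= in_itv/= => suv Iw; case: (dG s w Iw suv).
have GK s w : `]u, v[%classic s -> I w -> `|partial1of2 G s w| <= cst (K * M) w.
  rewrite /= in_itv/= => suv Iw; rewrite partial1of2E.
  have [_ ->] := dG s w Iw suv.
  rewrite normrM ler_pM//; first exact: phiK.
  apply: (fM (w, _)); split => //=; rewrite in_itv/=.
  by case/andP: suv => *; rewrite !ltW.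
have tuv : `]u, v[%classic t by rewrite /= in_itv/= ut.
have iK : leb.-integrable I (EFin \o cst (K * M)).
  by apply: segment_integrable; exact: within_cst.
have KM0 (w : R) : 0 <= cst (K * M) w by rewrite mulr_ge0.
split.
  by apply: (@derivable_under_integral R _ _ leb G I _ t u v tuv intG derG
    (cst (K * M)) KM0 iK GK); exact: measurable_itv.
have := @differentiation_under_integral R _ _ leb G I (measurable_itv _) t u v
  tuv intG derG (cst (K * M)) KM0 iK GK.
rewrite derive1E => ->; apply: segment_eq => w Iw.
by rewrite partial1of2E; have [_ ->] := dG t w Iw tuv.
Qed.

End Moments.

(** * Balance laws of the mass and of the energy *)

Section Balance.
Context {R : realType}.
Local Notation leb := (@lebesgue_measure R).
Local Notation I := `[(-1 : R), 1]%classic.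
Variables (al la be T : R) (f0 : R -> R) (f : R -> R -> R).
Hypothesis al_gt2 : 2 < al.
Hypothesis sol : smooth_solution al la be T f0 f.

Let al0 : 0 < al. Proof. exact: lt_trans al_gt2. Qed.

Lemma within_H (A : set R) : {within A, continuous (@H R)}.
Proof. by apply: withinB; [exact: within_cst|exact: within_sqr]. Qed.

Lemma H_itv (w : R) : -1 <= w <= 1 -> 0 <= H w <= 1.
Proof. by move=> /andP[? ?]; apply/andP; split; rewrite /H; nra. Qed.

Lemma within_Hf t : 0 <= t < T -> {within I, continuous (fun w => H w * f w t)}.
Proof. by move=> tT; apply: withinM; [exact: within_H|exact: (sol_cont_w sol)]. Qed.

Lemma Hf_cvg_left t : 0 <= t < T -> H w * f w t @[w --> (-1 : R)^'+] --> (0 : R).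
Proof.
move=> /within_Hf; have N11 : -1 < 1 :> R by lra.
move=> /(continuous_within_itvP _ N11)[_ + _].
by rewrite (_ : H (-1) = 0) ?mul0r// /H; ring.
Qed.

Lemma Hf_cvg_right t : 0 <= t < T -> H w * f w t @[w --> (1 : R)^'-] --> (0 : R).
Proof.
move=> /within_Hf; have N11 : -1 < 1 :> R by lra.
move=> /(continuous_within_itvP _ N11)[_ _].
by rewrite (_ : H 1 = 0) ?mul0r// /H; ring.
Qed.

(** The flux without its diffusive part. *)
Definition drift (t w : R) : R := w * f w t * (1 + be * H w `^ al * f w t `^ al).

Lemma within_drift t : 0 <= t < T -> {within I, continuous (drift t)}.
Proof.
move=> tT; have cf := sol_cont_w sol tT.
have f0' w : I w -> 0 <= f w t.
  by move=> Iw; apply: (sol_ge0 sol) => //; exact: Iw.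
apply: withinM; first by apply: withinM => //; exact: within_id.
apply: withinD; first exact: within_cst.
apply: withinM; last exact: within_powR.
apply: withinM; first exact: within_cst.
by apply: within_powR => //; [move=> w /H_itv/andP[]|exact: within_H].
Qed.

Lemma is_derive_flux (t w : R) : 0 < t < T -> -1 < w < 1 ->
  is_derive w 1 (flux al la be f t) ((f w)^`()%classic t).
Proof.
move=> tT wI; split; first exact: (sol_derivable_flux sol).
by rewrite -derive1E (sol_eq sol).
Qed.

Lemma mass_rate0 t : 0 < t < T -> intI (fun w => (f w)^`()%classic t) = 0.
Proof.
move=> tT; rewrite -[RHS](subrr 0).
apply: (@Rintegral_segment_ftc R _ (flux al la be f t)).
- by lra.
- exact: (sol_cont_dt_w sol).
- by move=> w; exact: is_derive_flux.
- exact: (sol_noflux_left sol).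
- exact: (sol_noflux_right sol).
Qed.

(** One primitive, [w^2 flux - 2 la w H f], does both integrations by parts at
    once, and involves the derivative of [H f] only through the flux; its two
    terms vanish at the end points by the no-flux conditions and by [H]. *)
Lemma energy_rate t : 0 < t < T ->
  intI (fun w => w ^+ 2 * (f w)^`()%classic t) =
  2 * la * intI (fun w => H w * f w t) - 2 * intI (fun w => w * drift t w).
Proof.
move=> tT; have tT' : 0 <= t < T by case/andP: tT => /ltW-> ->.
pose Q w := w ^+ 2 * flux al la be f t w - 2 * la * (w * (H w * f w t)).
have cdt := sol_cont_dt_w sol tT.
have cw2 : {within I, continuous (fun w => w ^+ 2 * (f w)^`()%classic t)}.
  by apply: withinM => //; exact: within_sqr.
have cHf := within_Hf tT'.
have cwd : {within I, continuous (fun w => w * drift t w)}.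
  by apply: withinM; [exact: within_id|exact: within_drift].
have cZ (c : R) h : {within I, continuous h} ->
    {within I, continuous (fun w => c * h w)}.
  by move=> ch; apply: withinM => //; exact: within_cst.
have dHf (w : R) : -1 < w < 1 -> is_derive w 1 (fun v => H v * f v t)
    ((fun v => H v * f v t)^`()%classic w).
  by move=> wI; rewrite derive1E; apply/derivableP; exact: (sol_derivable_Hf sol).
have QE : \int[leb]_(w in I) ((w ^+ 2 * (f w)^`()%classic t + 2 * (w * drift t w))
    - 2 * la * (H w * f w t)) = 0 - 0.
  apply: (@Rintegral_segment_ftc R _ Q).
  - by lra.
  - apply: withinB; last exact: cZ.
    by apply: withinD => //; exact: cZ.
  - move=> w wI.
    have d1 := is_derive_fM (is_derive_fsqr w) (is_derive_flux tT wI).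
    have d2 := is_derive_fM (is_derive_id w 1) (dHf _ wI).
    have d3 := is_derive_fM (is_derive_cst (2 * la) w 1) d2.
    have := is_derive_fB d1 d3.
    by move=> /is_derive_eq; apply; rewrite /flux /drift /=; ring.
  - suff : Q w @[w --> (-1 : R)^'+] --> (-1) ^+ 2 * 0 - 2 * la * (-1 * 0).
      by rewrite !mulr0 subr0.
    apply: cvgB; apply: cvgM.
    + by apply: cvg_at_right_filter; exact: exprn_continuous.
    + exact: (sol_noflux_left sol).
    + exact: cvg_cst.
    + by apply: cvgM; [apply: cvg_at_right_filter; exact: cvg_id|exact: Hf_cvg_left].
  - suff : Q w @[w --> (1 : R)^'-] --> 1 ^+ 2 * 0 - 2 * la * (1 * 0).
      by rewrite !mulr0 subr0.
    apply: cvgB; apply: cvgM.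
    + by apply: cvg_at_left_filter; exact: exprn_continuous.
    + exact: (sol_noflux_right sol).
    + exact: cvg_cst.
    + by apply: cvgM; [apply: cvg_at_left_filter; exact: cvg_id|exact: Hf_cvg_right].
move: QE; rewrite RintegralB//; first last.
- exact/segment_integrable/cZ.
- by apply: segment_integrable; apply: withinD => //; exact: cZ.
rewrite segmentD//; last exact: cZ.
by rewrite !segmentZ// /intI; lra.
Qed.

End Balance.

Section Dynamics.
Context {R : realType}.
Local Notation I := `[(-1 : R), 1]%classic.
Variables (al la be T : R) (f0 : R -> R) (f : R -> R -> R).
Hypotheses (al_gt2 : 2 < al) (be_gt0 : 0 < be).
Hypothesis mass_gt0 : 0 < mass f0.
Hypothesis sol : smooth_solution al la be T f0 f.
Local Notation mu := (mass f0).
Local Notation E := (fun t : R => energy (f ^~ t)).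

Let al0 : 0 < al. Proof. exact: lt_trans al_gt2. Qed.

Lemma f_ge0 t : 0 <= t < T -> forall w, -1 <= w <= 1 -> 0 <= f w t.
Proof. by move=> tT w wI; exact: (sol_ge0 sol). Qed.

Lemma mass_conserved t : 0 <= t < T -> mass (f ^~ t) = mu.
Proof.
move=> /andP[t0 tT].
have cM := moment_continuous sol (@within_cst R R I 1).
have dM := moment_is_derive sol (@within_cst R R I 1).
have massE s : mass (f ^~ s) = intI (fun w => 1 * f w s).
  by apply: segment_eq => w _; rewrite mul1r.
have -> : mu = mass (f ^~ 0) by apply: segment_eq => w wI; rewrite (sol_init sol).
rewrite !massE.
have sub s : s \in `]0, t[ -> 0 < s < T.
  by rewrite in_itv/= => /andP[-> /lt_trans]; exact.
move: t0; rewrite le_eqVlt => /predU1P[<-//|t0].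
have [|c] := MVT t0 (fun s hs => dM s (sub s hs)).
  by apply: continuous_subspaceW cM; apply: subset_itv; rewrite bnd_simp.
move=> /sub cT; have -> : intI (fun w => 1 * (f w)^`()%classic c) = 0.
  by rewrite -(mass_rate0 sol cT); apply: segment_eq => w _; rewrite mul1r.
by rewrite mul0r => /eqP; rewrite subr_eq0 => /eqP.
Qed.

Lemma energy_continuous : {within `[0, T[, continuous E}.
Proof. exact: (moment_continuous sol (@within_sqr R I)). Qed.

Lemma energy_is_derive t : 0 < t < T ->
  is_derive t 1 E (intI (fun w => w ^+ 2 * (f w)^`()%classic t)).
Proof. exact: (moment_is_derive sol (@within_sqr R I)). Qed.

Lemma energy_lower_bound t : 0 <= t < T ->
  64 * mu ^+ 5 <= 5 ^+ 5 * E t * sqL2norm (f ^~ t) ^+ 2.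
Proof.
move=> tT; rewrite -(mass_conserved tT).
by apply: mass5_le_energy_L2; [exact: (sol_cont_w sol)|exact: f_ge0].
Qed.

Lemma energy_gt0 t : 0 <= t < T -> 0 < E t.
Proof.
move=> tT; rewrite lt_neqAle; apply/andP; split; last first.
  by apply: segment_ge0 => w wI; rewrite mulr_ge0 ?sqr_ge0 ?f_ge0.
apply/eqP => E0; have := energy_lower_bound tT.
by rewrite -E0 mulr0 mul0r leNgt mulr_gt0 ?exprn_gt0.
Qed.

Lemma energy_le_mass t : 0 <= t < T -> E t <= mu.
Proof.
move=> tT; rewrite -(mass_conserved tT); have cf := sol_cont_w sol tT.
apply: segment_le => //; first by apply: withinM => //; exact: within_sqr.
move=> w wI; rewrite -[leRHS]mul1r ler_wpM2r ?f_ge0//.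
by have /andP[] := H_itv wI; rewrite /H; lra.
Qed.

Lemma mass_H t : 0 <= t < T -> intI (fun w => H w * f w t) = mu - E t.
Proof.
move=> tT; rewrite -(mass_conserved tT); have cf := sol_cont_w sol tT.
rewrite /mass /energy /intI -RintegralB//; first last.
- by apply: segment_integrable; apply: withinM => //; exact: within_sqr.
- exact: segment_integrable.
by apply: segment_eq => w _; rewrite /H; ring.
Qed.

(** The diffusion contributes [2 la (mu - E)]; in the drift, [H <= 1] lets
    [H^al f^(al+1)] be replaced by [(H f)^(al+1)], to which the weighted
    inequality applies. *)
Lemma energy_rate_le t : 0 <= la -> 0 < t < T ->
  intI (fun w => w ^+ 2 * (f w)^`()%classic t) <= Phi al la be mu (E t).
Proof.
move=> la0 tT; have tT' : 0 <= t < T by case/andP: tT => /ltW-> ->.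
have e0 := energy_gt0 tT'.
have cHf := within_Hf sol tT'.
have Hf0 w : -1 <= w <= 1 -> 0 <= H w * f w t.
  by move=> wI; rewrite mulr_ge0 ?f_ge0//; case/andP: (H_itv wI).
have cHfp : {within I, continuous (fun w => w ^+ 2 * (H w * f w t) `^ (al + 1))}.
  by apply: withinM; [exact: within_sqr|apply: within_powR; rewrite ?addr_gt0].
set P := intI (fun w => w ^+ 2 * (H w * f w t) `^ (al + 1)).
have HfE : energy (fun w => H w * f w t) <= E t.
  apply: segment_le.
  - by apply: withinM => //; exact: within_sqr.
  - by apply: withinM; [exact: within_sqr|exact: (sol_cont_w sol)].
  - move=> w wI; rewrite ler_wpM2l ?sqr_ge0// -[leRHS]mul1r.
    by rewrite ler_wpM2r ?f_ge0//; case/andP: (H_itv wI).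
have := mass_le_energy_weighted al_gt2 e0 cHf Hf0 HfE.
rewrite -/P (mass_H tT' : mass _ = _) => muP.
have driftP : be * P <= intI (fun w => w * drift al be f t w).
  rewrite /P /intI -segmentZ//; apply: segment_le.
  - by apply: withinM => //; exact: within_cst.
  - by apply: withinM; [exact: within_id|exact: (within_drift al_gt2 sol)].
  move=> w wI; have f0' := f_ge0 tT' wI; have /andP[H0 H1] := H_itv wI.
  have -> : (H w * f w t) `^ (al + 1) = H w `^ al * f w t `^ al * (H w * f w t).
    rewrite powRD ?powRr1 ?Hf0// ?powRM//.
    by rewrite gt_eqF// addr_gt0.
  have -> : w * drift al be f t w =
      w ^+ 2 * f w t + be * (w ^+ 2 * (H w `^ al * f w t `^ al * f w t)).
    by rewrite /drift; ring.
  have w2f : 0 <= w ^+ 2 * f w t by rewrite mulr_ge0 ?sqr_ge0.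
  apply: (le_trans _ (lerD w2f (lexx _))); rewrite add0r.
  apply: ler_wpM2l (ltW be_gt0) _ _ _; apply: ler_wpM2l (sqr_ge0 _) _ _ _.
  apply: ler_wpM2l; first by rewrite mulr_ge0 ?powR_ge0.
  by rewrite -[leRHS]mul1r ler_wpM2r.
rewrite (energy_rate al_gt2 sol)// mass_H// /Phi.
have c0 : 0 < C_ al `^ (3 * al / 2) by rewrite powR_gt0// C_gt0.
have g0 : 0 < E t `^ ((al - 2) / 2) by rewrite powR_gt0.
set M := (mu - E t) `^ (3 * al / 2) in muP *.
have MP : M / (C_ al `^ (3 * al / 2) * E t `^ ((al - 2) / 2)) <= P.
  by rewrite ler_pdivrMr ?mulr_gt0// mulrC.
have -> : 2 * be / C_ al `^ (3 * al / 2) * (M / E t `^ ((al - 2) / 2)) =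
    2 * (be * (M / (C_ al `^ (3 * al / 2) * E t `^ ((al - 2) / 2)))).
  by rewrite invfM; ring.
have := ler_wpM2l (ltW be_gt0) MP.
have := mulr_ge0 la0 (ltW e0).
by move: driftP => /=; lra.
Qed.

End Dynamics.

(** * The threshold functions *)

Section Thresholds.
Context {R : realType}.
Variables al la be : R.
Hypotheses (al_gt2 : 2 < al) (la_gt0 : 0 < la) (be_gt0 : 0 < be).

Let al0 : 0 < al. Proof. exact: lt_trans al_gt2. Qed.
Let k0 : 0 < 3 * al / 2. Proof. by rewrite divr_gt0// mulr_gt0. Qed.
Let Ck0 : 0 < C_ al `^ (3 * al / 2). Proof. by rewrite powR_gt0// C_gt0. Qed.

Lemma gamma_gt0 : 0 < gamma al.
Proof. by rewrite divr_gt0// subr_gt0. Qed.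

Lemma PhiE (mu e : R) :
  Phi al la be mu e = 2 * la * mu - Lambda al be mu e / e `^ gamma al.
Proof. by rewrite /Phi /Lambda /gamma; congr (_ - _); ring. Qed.

Lemma Lambda_ge0 (mu e : R) : 0 <= Lambda al be mu e.
Proof.
by rewrite /Lambda divr_ge0 ?(ltW Ck0)// mulr_ge0 ?powR_ge0// mulr_ge0// ltW.
Qed.

Lemma Lambda_anti (mu e e' : R) : e <= e' -> e' <= mu ->
  Lambda al be mu e' <= Lambda al be mu e.
Proof.
move=> ee' e'mu; rewrite /Lambda ler_pM2r ?invr_gt0// ler_pM2l ?mulr_gt0//.
by rewrite ge0_ler_powR ?nnegrE ?(ltW k0)//; lra.
Qed.

Lemma Phi_mono (mu e e' : R) : 0 < e -> e <= e' -> e' <= mu ->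
  Phi al la be mu e <= Phi al la be mu e'.
Proof.
move=> e0 ee' e'mu; rewrite !PhiE lerD2l lerN2.
have e'0 := lt_le_trans e0 ee'.
apply: ler_pM; rewrite ?Lambda_ge0 ?invr_ge0 ?powR_ge0 ?Lambda_anti//.
rewrite lef_pV2 ?posrE ?powR_gt0//.
by rewrite ge0_ler_powR ?nnegrE ?(ltW gamma_gt0)// ltW.
Qed.

Lemma Phi_lt_mu (mu e : R) : 0 < mu -> e <= mu -> Phi al la be mu e < 0 -> e < mu.
Proof.
move=> mu0 emu Ph; rewrite lt_neqAle emu andbT; apply/eqP => eE.
move: Ph; rewrite /Phi eE subrr powR0 ?gt_eqF// mul0r mulr0 subr0.
by rewrite ltNge mulr_ge0// ?mulr_ge0// ltW.
Qed.

Lemma Phi_lt0_right (mu e : R) : 0 < e < mu -> Phi al la be mu e < 0 ->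
  exists2 e', e < e' <= mu & Phi al la be mu e' < 0.
Proof.
move=> /andP[e0 emu] Ph.
have cPhi : {for e, continuous (Phi al la be mu)}.
  apply: cvgB; first exact: cvg_cst.
  apply: cvgM; first exact: cvg_cst.
  apply: cvgM.
    apply: (@cvg_comp _ _ _ (fun x => mu - x) (fun y : R => y `^ (3 * al / 2))).
      by apply: cvgB; [exact: cvg_cst|exact: cvg_id].
    by apply: continuous_powR_gt0; rewrite subr_gt0.
  by apply: cvgV; [rewrite gt_eqF ?powR_gt0|exact: continuous_powR_gt0].
have nPhi : \forall x \near e^'+, Phi al la be mu x < 0.
  by apply: cvgr_lt Ph; exact: cvg_at_right_filter.
near (e^'+)%classic => x; exists x; last by near: x.
by apply/andP; split; [near: x; exact: nbhs_right_gt|near: x; exact: nbhs_right_le].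
Unshelve. all: by end_near. Qed.

Lemma Phi_Psi (mu e : R) : 0 < mu -> 0 < e <= mu ->
  Phi al la be mu e = mu * Psi al la be mu (e / mu).
Proof.
move=> mu0 /andP[e0 emu]; rewrite /Phi /Psi.
have em : 1 - e / mu = (mu - e) / mu by field; rewrite gt_eqF.
rewrite em !powRM ?invr_ge0 ?subr_ge0 ?(ltW mu0) ?(ltW e0)//.
have pV r : mu^-1 `^ r = (mu `^ r)^-1.
  by rewrite -powR_inv1 ?(ltW mu0)// -powRrM mulN1r powRN.
rewrite !pV.
have -> : mu `^ (3 * al / 2) = mu * mu `^ al * mu `^ ((al - 2) / 2).
  rewrite -{2}(powRr1 (ltW mu0)) -!powRD ?(gt_eqF mu0)/= ?implybT//.
  by congr (_ `^ _); field.
field.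
by rewrite !(gt_eqF (powR_gt0 _ _)) ?(gt_eqF mu0)//; exact: C_gt0.
Qed.

Lemma Phi_lt0_small (mu : R) : 0 < mu ->
  exists Ec : R, 0 < Ec < mu /\ forall e : R, 0 < e < Ec -> Phi al la be mu e < 0.
Proof.
move=> mu0; have g0 := gamma_gt0.
pose L := Lambda al be mu (mu / 2).
have L0 : 0 < L.
  rewrite divr_gt0// mulr_gt0 ?mulr_gt0// powR_gt0//; lra.
pose r := (L / (2 * la * mu)) `^ (gamma al)^-1.
have q0 : 0 < L / (2 * la * mu) by apply: divr_gt0 => //; rewrite !mulr_gt0.
have r0 : 0 < r by exact: powR_gt0.
exists (Num.min (mu / 2) r); split.
  by rewrite lt_min r0 divr_gt0// gt_min; apply/orP; left; lra.
move=> e /andP[e0]; rewrite lt_min => /andP[emu er].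
rewrite PhiE subr_lt0 ltr_pdivlMr ?powR_gt0//.
apply: (@lt_le_trans _ _ L); last by apply: Lambda_anti; lra.
rewrite mulrC -ltr_pdivlMr ?mulr_gt0//.
have -> : L / (2 * la * mu) = r `^ gamma al.
  by rewrite -powRrM mulVf ?gt_eqF// powRr1 ?ltW.
by rewrite gt0_ltr_powR ?nnegrE ?(ltW e0) ?powR_ge0.
Qed.

Lemma Psi_lt0_large (e mu : R) : 0 < e < 1 ->
  mass_threshold al la be e < mu -> Psi al la be mu e < 0.
Proof.
move=> /andP[e0 e1] tmu.
have p0 : 0 < (1 - e) `^ (3 * al / 2) by rewrite powR_gt0 ?subr_gt0.
have q0 : 0 < e `^ ((al - 2) / 2) by rewrite powR_gt0.
set X := la * C_ al `^ (3 * al / 2) / be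
  * (e `^ ((al - 2) / 2) / (1 - e) `^ (3 * al / 2)).
have X0 : 0 < X by rewrite mulr_gt0 ?divr_gt0 ?mulr_gt0.
have Xmu : X < mu `^ al.
  have -> : X = (X `^ al^-1) `^ al.
    by rewrite -powRrM mulVf ?gt_eqF// powRr1 ?ltW.
  rewrite gt0_ltr_powR ?nnegrE ?powR_ge0//.
  by apply: ltW; apply: le_lt_trans tmu; exact: powR_ge0.
rewrite /Psi subr_lt0.
have -> : 2 * la = 2 * be / C_ al `^ (3 * al / 2) * X *
    ((1 - e) `^ (3 * al / 2) / e `^ ((al - 2) / 2)).
  rewrite /X; field.
  by rewrite ?(gt_eqF p0) ?(gt_eqF q0) ?(gt_eqF Ck0) ?(gt_eqF be_gt0).
by rewrite ltr_pM2r ?divr_gt0// ltr_pM2l// divr_gt0// mulr_gt0.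
Qed.

End Thresholds.

(** * Decay of the energy from the differential inequality *)

Section Barrier.
Context {R : realType}.
Variables (T : R) (e D : R -> R).
Hypothesis ce : {within `[0, T[, continuous e}.
Hypothesis de : forall t, 0 < t < T -> is_derive t 1 e (D t).

Lemma increment t : 0 < t < T ->
  exists2 c, 0 < c < t & e t - e 0 = D c * t.
Proof.
move=> /andP[t0 tT].
have sub s : s \in `]0, t[ -> 0 < s < T.
  by rewrite in_itv/= => /andP[-> /lt_trans]; exact.
have [|c] := MVT t0 (fun s hs => de (sub s hs)).
  by apply: continuous_subspaceW ce; apply: subset_itv; rewrite bnd_simp.
by rewrite in_itv/= subr0 => c0t ec; exists c.
Qed.

(** Until the first time at which [e] reaches [b] it decreases, so that it is then
    below [e 0], hence below [b]. *)
Lemma barrier (b : R) : e 0 < b ->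
  (forall t, 0 < t < T -> e t < b -> D t < 0) ->
  forall t, 0 <= t < T -> e t < b.
Proof.
move=> e0b Db t /andP[t0 tT]; rewrite ltNge; apply/negP => bt.
pose A := [set s | 0 <= s <= t /\ b <= e s].
have At : A t by split=> //; rewrite t0 lexx.
have lbA : lbound A 0 by move=> s [/andP[]].
have hA : has_inf A by split; [exists t|exists 0].
pose s := inf A.
have s0 : 0 <= s by apply: lb_le_inf => //; exists t.
have st : s <= t by apply: ge_inf => //; exists 0.
have below r : 0 <= r < s -> e r < b.
  move=> /andP[r0 rs]; rewrite ltNge; apply/negP => br.
  have : s <= r.
    by apply: ge_inf; [exists 0|split => //; rewrite r0/= ltW// (lt_le_trans rs)].
  by rewrite leNgt rs.
have bs : b <= e s.
  rewrite leNgt; apply/negP => esb.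
  move/subspace_continuousP : (ce) => /(_ s).
  have sI : `[0, T[%classic s by rewrite /= in_itv/= s0 (le_lt_trans st).
  move=> /(_ sI) /cvgr_lt /(_ _ esb) [d /= d0 sd].
  have [r Ar rs] := inf_adherent d0 hA.
  have sr : s <= r by apply: ge_inf => //; exists 0.
  case: Ar => /andP[r0 rt]; rewrite leNgt => /negP; apply.
  apply: (sd r); first by rewrite /= ler0_norm ?subr_le0// opprB ltrBlDl.
  by rewrite /= in_itv/= r0 (le_lt_trans rt).
have s_gt0 : 0 < s.
  by rewrite lt_neqAle s0 andbT; apply/eqP => s0'; move: bs; rewrite -s0' leNgt e0b.
have sT := le_lt_trans st tT.
have [|c /andP[c0 cs] ec] := increment (t := s); first by rewrite s_gt0.
have : e s - e 0 < 0.
  rewrite ec pmulr_llt0//; apply: Db; first by rewrite c0 (lt_trans cs).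
  by apply: below; rewrite ltW.
by rewrite subr_lt0 ltNge (le_trans (ltW e0b)).
Qed.

End Barrier.

Section Decay.
Context {R : realType}.
Variables (al la be mu T : R) (e D : R -> R).
Hypotheses (al_gt2 : 2 < al) (la_gt0 : 0 < la) (be_gt0 : 0 < be).
Hypotheses (mu_gt0 : 0 < mu) (T_gt0 : 0 < T).
Hypothesis ce : {within `[0, T[, continuous e}.
Hypothesis de : forall t, 0 < t < T -> is_derive t 1 e (D t).
Hypothesis De : forall t, 0 < t < T -> D t <= Phi al la be mu (e t).
Hypothesis e_gt0 : forall t, 0 <= t < T -> 0 < e t.
Hypothesis e_le_mu : forall t, 0 <= t < T -> e t <= mu.
Hypothesis Phi0 : Phi al la be mu (e 0) < 0.
Local Notation g := (gamma al).
Local Notation La := (Lambda al be mu (e 0)).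
Local Notation K := (La - 2 * la * mu * e 0 `^ g).

Let zeroT : 0 <= (0 : R) < T. Proof. by rewrite lexx. Qed.
Let itvW (t : R) : 0 < t < T -> 0 <= t < T. Proof. by case/andP=> /ltW-> ->. Qed.

Lemma extinction_rate_gt0 : 0 < K.
Proof.
have := Phi0; rewrite PhiE subr_lt0 ltr_pdivlMr ?powR_gt0 ?e_gt0//.
by rewrite subr_gt0.
Qed.

(** The differential inequality gives a negative rate only as long as
    [Phi (e t) < 0]; a level [e1] slightly above [e 0], where [Phi] is still
    negative, serves as a barrier. *)
Lemma energy_le_initial t : 0 <= t < T -> e t <= e 0.
Proof.
have [|e1 /andP[e01 e1mu] Phi1] := Phi_lt0_right _ Phi0.
  by rewrite e_gt0 ?(Phi_lt_mu al_gt2 la_gt0 mu_gt0 (e_le_mu _) Phi0).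
have neg s : 0 < s < T -> e s < e1 -> D s < 0.
  move=> sT es1; apply: (le_lt_trans (De sT)); apply: le_lt_trans Phi1.
  by apply: Phi_mono => //; [exact/e_gt0/itvW|exact: ltW].
have ee1 := barrier ce de e01 neg.
move=> /andP[]; rewrite le_eqVlt => /predU1P[<-//|t0] tT.
have [|c /andP[c0 ct] ec] := increment ce de (t := t); first by rewrite t0.
have cT : 0 < c < T by rewrite c0 (lt_trans ct).
by rewrite -subr_le0 ec nmulr_rle0 ?ltW//; apply: neg => //; exact/ee1/itvW.
Qed.

(** By monotonicity of the energy, the factor [mu - e t] of the drain can be
    replaced by its initial value. *)
Lemma rate_le t : 0 < t < T -> D t <= 2 * la * mu - La / e t `^ g.
Proof.
move=> tT; apply: (le_trans (De tT)); rewrite PhiE lerD2l lerN2.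
rewrite ler_pM2r ?invr_gt0 ?powR_gt0 ?e_gt0 ?itvW//.
by apply: Lambda_anti => //; [exact/energy_le_initial/itvW|exact: e_le_mu].
Qed.

Lemma rate_le_K t : 0 <= t < T ->
  2 * la * mu - La / e t `^ g <= - (K / e t `^ g).
Proof.
move=> tT; have g0 : 0 < e t `^ g by rewrite powR_gt0 ?e_gt0.
rewrite mulrBl opprB lerD2r ler_pdivlMr// ler_pM2l ?mulr_gt0//.
rewrite ge0_ler_powR ?nnegrE ?(ltW (gamma_gt0 al_gt2)) ?(ltW (e_gt0 _))//.
exact: energy_le_initial.
Qed.

Lemma energy_power_decay t : 0 <= t < T ->
  e t `^ (g + 1) <= e 0 `^ (g + 1) - (g + 1) * K * t.
Proof.
move=> /andP[]; rewrite le_eqVlt => /predU1P[<-|t0 tT]; first by rewrite mulr0 subr0.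
have g0 := gamma_gt0 al_gt2.
have g1 : 0 < g + 1 by rewrite addr_gt0.
have cep : {within `[0, T[, continuous (fun s => e s `^ (g + 1))}.
  apply: within_powR => // s; rewrite /= in_itv/= => sT.
  exact/ltW/e_gt0.
have dep s : 0 < s < T ->
    is_derive s 1 (fun s => e s `^ (g + 1)) ((g + 1) * e s `^ (g + 1 - 1) * D s).
  by move=> sT; apply: is_derive_fpowR; [exact/e_gt0/itvW|exact: de].
have [|c /andP[c0 ct] ec] := increment cep dep (t := t); first by rewrite t0.
have cT : 0 < c < T by rewrite c0 (lt_trans ct).
suff : (g + 1) * e c `^ (g + 1 - 1) * D c <= - ((g + 1) * K).
  move=> h; rewrite -lerBlDl; rewrite ec -mulNr ler_pM2r//.
rewrite addrK -mulrA -mulrN ler_pM2l//.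
have p0 : 0 < e c `^ g by rewrite powR_gt0 ?e_gt0 ?itvW.
rewrite mulrC -ler_pdivlMr// mulNr.
exact: le_trans (rate_le cT) (rate_le_K (itvW cT)).
Qed.

Lemma tbarK : (g + 1) * K * tbar al la be mu (e 0) = e 0 `^ (g + 1).
Proof.
rewrite /tbar mulrC divfK// gt_eqF// mulr_gt0 ?extinction_rate_gt0//.
by rewrite addr_gt0// gamma_gt0.
Qed.

(** Otherwise [energy_power_decay] at time [tbar] would make the energy vanish. *)
Lemma extinction_bound : T <= tbar al la be mu (e 0).
Proof.
have g1 : 0 < g + 1 by rewrite addr_gt0// gamma_gt0.
rewrite leNgt; apply/negP => tbT.
have tb0 : 0 <= tbar al la be mu (e 0).
  by rewrite divr_ge0 ?powR_ge0// mulr_ge0 ?ltW ?extinction_rate_gt0.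
have := energy_power_decay (t := tbar al la be mu (e 0)).
rewrite tb0 tbT => /(_ isT).
rewrite tbarK subrr leNgt powR_gt0// e_gt0//.
by rewrite tb0.
Qed.

Lemma energy_extinction : tbar al la be mu (e 0) <= T ->
  e t @[t --> (tbar al la be mu (e 0))^'-] --> (0 : R).
Proof.
move=> tbT.
have tbE : tbar al la be mu (e 0) = T.
  by apply/eqP; rewrite eq_le tbT extinction_bound.
have g1 : 0 < g + 1 by rewrite addr_gt0// gamma_gt0.
have KT : (g + 1) * K * T = e 0 `^ (g + 1).
  by rewrite -tbE tbarK.
rewrite tbE.
apply/cvgrPdist_lt => x x0.
have xp0 : 0 < x `^ (g + 1) by rewrite powR_gt0.
have cT : (g + 1) * K * t @[t --> T^'-] --> (g + 1) * K * T.
  by apply: cvg_at_left_filter; apply: cvgM; [exact: cvg_cst|exact: cvg_id].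
near=> t.
have tT : 0 <= t < T.
  by apply/andP; split; [near: t; exact: nbhs_left_ge|near: t; exact: nbhs_left_lt].
have et := e_gt0 tT.
rewrite sub0r normrN gtr0_norm// ltNge; apply/negP => xe.
have : x `^ (g + 1) <= e t `^ (g + 1).
  by rewrite ge0_ler_powR ?nnegrE ?(ltW g1) ?(ltW x0) ?(ltW et).
apply/negP; rewrite -ltNge; apply: (le_lt_trans (energy_power_decay tT)).
rewrite -KT ltrBlDr -ltrBlDl.
near: t; apply: cvgr_gt cT _ _; lra.
Unshelve. all: by end_near. Qed.

End Decay.

(** * Concentration at the origin and blow-up *)

Section Concentration.
Context {R : realType}.
Local Notation I := `[(-1 : R), 1]%classic.
Implicit Types (g phi : R -> R).

Lemma second_moment_about g (c : R) : {within I, continuous g} ->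
  intI (fun w => (w - c) ^+ 2 * g w) =
  energy g - 2 * c * mean g + c ^+ 2 * mass g.
Proof.
move=> cg; have cw1 : {within I, continuous (fun w => w * g w)}.
  by apply: withinM => //; exact: within_id.
have cw2 : {within I, continuous (fun w => w ^+ 2 * g w)}.
  by apply: withinM => //; exact: within_sqr.
have cZ (a : R) h : {within I, continuous h} ->
    {within I, continuous (fun w => a * h w)}.
  by move=> ch; apply: withinM => //; exact: within_cst.
have := segmentD (withinB cw2 (cZ (2 * c) _ cw1)) (cZ (c ^+ 2) _ cg).
rewrite RintegralB//; try exact: segment_integrable; last exact/segment_integrable/cZ.
rewrite !segmentZ// => <-; apply: segment_eq => w _; ring.
Qed.

(** The second moment about the centre of mass is nonnegative. *)
Lemma mean_sqr_le g : {within I, continuous g} ->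
  (forall w, -1 <= w <= 1 -> 0 <= g w) -> 0 < mass g ->
  mean g ^+ 2 <= mass g * energy g.
Proof.
move=> cg g0 m0; have := second_moment_about (mean g / mass g) cg.
have : 0 <= intI (fun w => (w - mean g / mass g) ^+ 2 * g w).
  by apply: segment_ge0 => w wI; rewrite mulr_ge0 ?sqr_ge0 ?g0.
move=> + vE; rewrite vE.
have -> : energy g - 2 * (mean g / mass g) * mean g + (mean g / mass g) ^+ 2 * mass g
   = (mass g * energy g - mean g ^+ 2) / mass g by field; rewrite gt_eqF.
by rewrite pmulr_lge0 ?invr_gt0// subr_ge0.
Qed.

Lemma centered_energyE g : {within I, continuous g} ->
  centered_energy g = energy g - 2 * mean g * mean g + mean g ^+ 2 * mass g.
Proof. exact: second_moment_about. Qed.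

(** Near [0] by continuity, away from [0] because [phi] is bounded. *)
Lemma quadratic_modulus phi (x : R) : {within I, continuous phi} -> 0 < x ->
  exists2 C, 0 <= C & forall w, -1 <= w <= 1 -> `|phi w - phi 0| <= x + C * w ^+ 2.
Proof.
move=> cphi x0.
have [K K0 phiK] := within_compact_bounded (@segment_compact R _ _) cphi.
have I0 : I 0 by rewrite /= in_itv/=; apply/andP; split; lra.
move/subspace_continuousP : (cphi) => /(_ 0 I0) /cvgrPdist_lt /(_ _ x0) [d /= d0 phid].
exists (2 * K / d ^+ 2); first by rewrite divr_ge0 ?sqr_ge0 ?mulr_ge0.
move=> w wI; have [wd|dw] := ltP `|w| d.
  rewrite distrC; apply: (@le_trans _ _ x); last first.
    by rewrite lerDl mulr_ge0 ?sqr_ge0// divr_ge0 ?sqr_ge0 ?mulr_ge0.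
  by apply/ltW/phid; rewrite //= sub0r normrN.
apply: (@le_trans _ _ (2 * K)).
  apply: (le_trans (ler_normB _ _)); rewrite mulrDl mul1r lerD//; exact: phiK.
apply: (@le_trans _ _ (2 * K / d ^+ 2 * w ^+ 2)); last by rewrite lerDr ltW.
rewrite mulrAC ler_pdivlMr ?exprn_gt0// ler_wpM2l ?mulr_ge0//.
rewrite -[leRHS]real_normK ?num_real// lerXn2r// nnegrE// ltW//.
Qed.

Lemma concentration_le g phi (x C : R) : {within I, continuous g} ->
  {within I, continuous phi} ->
  (forall w, -1 <= w <= 1 -> 0 <= g w) ->
  (forall w, -1 <= w <= 1 -> `|phi w - phi 0| <= x + C * w ^+ 2) ->
  `|intI (fun w => phi w * g w) - phi 0 * mass g| <= x * mass g + C * energy g.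
Proof.
move=> cg cphi g0 phiC.
have cw2 : {within I, continuous (fun w => w ^+ 2 * g w)}.
  by apply: withinM => //; exact: within_sqr.
have cZ (a : R) h : {within I, continuous h} ->
    {within I, continuous (fun w => a * h w)}.
  by move=> ch; apply: withinM => //; exact: within_cst.
have cpg : {within I, continuous (fun w => phi w * g w)} by exact: withinM.
rewrite /mass /energy /intI -!segmentZ// -segmentD; try exact: cZ.
rewrite -RintegralB//; first last.
- exact/segment_integrable/cZ.
- exact: segment_integrable.
have cd : {within I, continuous (fun w => phi w * g w - phi 0 * g w)}.
  by apply: withinB => //; exact: cZ.
have cn : {within I, continuous (fun w => `|phi w * g w - phi 0 * g w|)}.
  move=> w; exact: (cvg_norm (cd w)).
apply: le_trans.
  by apply: le_normr_Rintegral => //; exact: segment_integrable.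
apply: segment_le => //; first by apply: withinD; exact: cZ.
move=> w wI; rewrite -mulrBl normrM (ger0_norm (g0 _ wI)) mulrA -mulrDl.
by rewrite ler_wpM2r ?g0 ?phiC.
Qed.

Lemma dirac_integral phi : {within I, continuous phi} ->
  \int[\d_(0 : R)]_(w in I) phi w = phi 0.
Proof.
move=> cphi; rewrite /Rintegral integral_dirac//.
  rewrite diracE mem_set ?mul1e//.
  by rewrite /= in_itv/=; apply/andP; split; lra.
exact: measurable_int (segment_integrable cphi).
Qed.

End Concentration.

Section Conclusions.
Context {R : realType}.
Local Notation I := `[(-1 : R), 1]%classic.
Variables (al la be T : R) (f0 : R -> R) (f : R -> R -> R).
Hypothesis mass_gt0 : 0 < mass f0.
Hypothesis sol : smooth_solution al la be T f0 f.
Local Notation mu := (mass f0).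
Local Notation E := (fun t : R => energy (f ^~ t)).

Lemma energy_ge t : 0 <= t < T ->
  E t >= (1 / 5) ^+ 5
         * ((2 * Num.sqrt 2) ^+ 4 * mu ^+ 5 / sqL2norm (f ^~ t) ^+ 2).
Proof.
move=> tT; have e0 := energy_gt0 mass_gt0 sol tT.
have [->|S0] := eqVneq (sqL2norm (f ^~ t)) 0.
  by rewrite expr0n/= invr0 !mulr0 ltW.
have S2 : 0 < sqL2norm (f ^~ t) ^+ 2 by rewrite exprn_even_gt0.
have -> : (2 * Num.sqrt 2) ^+ 4 = 64 :> R.
  have s2 : Num.sqrt 2 ^+ 2 = 2 :> R by rewrite sqr_sqrtr.
  have -> : (2 * Num.sqrt 2) ^+ 4 = 16 * (Num.sqrt 2 ^+ 2) ^+ 2 :> R by ring.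
  by rewrite s2; ring.
rewrite mulrA ler_pdivrMr//.
have /= := energy_lower_bound sol tT; rewrite -mulrA.
by move: (_ * _ ^+ 2) => X; lra.
Qed.

Lemma near_left_itv (t0 : R) : 0 < t0 -> t0 <= T ->
  \forall t \near t0^'-, 0 <= t < T.
Proof.
move=> t00 t0T; near=> t; apply/andP; split.
  by near: t; exact: nbhs_left_ge.
by apply: lt_le_trans t0T; near: t; exact: nbhs_left_lt.
Unshelve. all: by end_near. Qed.

Lemma L2_blowup (t0 : R) : 0 < t0 -> t0 <= T ->
  E t @[t --> t0^'-] --> (0 : R) ->
  Num.sqrt (sqL2norm (f ^~ t)) @[t --> t0^'-] --> +oo.
Proof.
move=> t00 t0T E0; apply/cvgryPgt => A.
pose B := Num.max A 1.
have B0 : 0 < B by rewrite lt_max ltr01 orbT.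
have d0 : 0 < 64 * mu ^+ 5 / (5 ^+ 5 * B ^+ 4).
  by rewrite divr_gt0// mulr_gt0// exprn_gt0.
near=> t.
have tT : 0 <= t < T by near: t; exact: near_left_itv.
have Et : E t < 64 * mu ^+ 5 / (5 ^+ 5 * B ^+ 4).
  by near: t; exact: (cvgr_lt _ E0 _ d0).
have et := energy_gt0 mass_gt0 sol tT.
have S0 : 0 <= sqL2norm (f ^~ t) by apply: segment_ge0 => w _; exact: sqr_ge0.
apply: (@le_lt_trans _ _ B); first by rewrite le_max lexx.
rewrite ltNge; apply/negP => SB.
have S2 : sqL2norm (f ^~ t) ^+ 2 <= B ^+ 4.
  rewrite -(sqr_sqrtr S0) -exprM lerXn2r// nnegrE; [exact: sqrtr_ge0|exact: ltW].
have := energy_lower_bound sol tT; apply/negP; rewrite -ltNge.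
move: Et; rewrite ltr_pdivlMr ?mulr_gt0 ?exprn_gt0// => Et.
apply: le_lt_trans Et; rewrite -mulrA mulrCA ler_wpM2l ?(ltW et)//.
by rewrite ler_wpM2l// exprn_ge0.
Unshelve. all: by end_near. Qed.

Lemma concentration (t0 : R) : 0 < t0 -> t0 <= T ->
  E t @[t --> t0^'-] --> (0 : R) ->
  [/\ mean (f ^~ t) @[t --> t0^'-] --> (0 : R),
      centered_energy (f ^~ t) @[t --> t0^'-] --> (0 : R) &
      forall phi : R -> R, {within I, continuous phi} ->
        intI (fun w => phi w * f w t) @[t --> t0^'-]
          --> mu * \int[\d_(0 : R)]_(w in I) phi w].
Proof.
move=> t00 t0T E0.
have m0 : mean (f ^~ t) @[t --> t0^'-] --> (0 : R).
  apply/cvgrPdist_lt => x x0; near=> t.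
  have tT : 0 <= t < T by near: t; exact: near_left_itv.
  rewrite sub0r normrN -(@ltr_pXn2r _ 2) ?nnegrE ?(ltW x0)//.
  rewrite real_normK ?num_real//.
  have Em : E t < x ^+ 2 / mu.
    by near: t; apply: (cvgr_lt _ E0); rewrite divr_gt0// exprn_gt0.
  apply: le_lt_trans (mean_sqr_le (sol_cont_w sol tT) (f_ge0 sol tT) _) _.
    by rewrite (mass_conserved sol).
  rewrite (mass_conserved sol)//.
  by move: Em; rewrite ltr_pdivlMr// mulrC.
split=> // [|phi cphi].
  suff : energy (f ^~ t) - 2 * mean (f ^~ t) * mean (f ^~ t)
      + mean (f ^~ t) ^+ 2 * mu @[t --> t0^'-] --> 0 - 2 * 0 * 0 + 0 * 0 * mu.
    rewrite !(mul0r, mulr0) subr0 addr0; apply: cvg_trans.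
    apply: near_eq_cvg; near=> t.
    have tT : 0 <= t < T by near: t; exact: near_left_itv.
    by rewrite (centered_energyE (sol_cont_w sol tT)) (mass_conserved sol).
  apply: cvgD.
    by apply: cvgB => //; apply: cvgM => //; apply: cvgM => //; exact: cvg_cst.
  by apply: cvgM; [exact: cvgM|exact: cvg_cst].
rewrite dirac_integral// mulrC; apply/cvgrPdist_lt => x x0.
have x'0 : 0 < x / (2 * mu) by rewrite divr_gt0// mulr_gt0.
have [C C0 phiC] := quadratic_modulus cphi x'0.
near=> t.
have tT : 0 <= t < T by near: t; exact: near_left_itv.
have := concentration_le (sol_cont_w sol tT) cphi (f_ge0 sol tT) phiC.
rewrite distrC (mass_conserved sol)// => /le_lt_trans; apply.
have EC : E t < x / (2 * (C + 1)).
  by near: t; apply: (cvgr_lt _ E0); rewrite divr_gt0// mulr_gt0// ltr_wpDl.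
have et := energy_gt0 mass_gt0 sol tT.
have -> : x / (2 * mu) * mu = x / 2 by field; rewrite gt_eqF.
move: EC => /=; rewrite ltr_pdivlMr ?mulr_gt0// ?ltr_wpDl//; move: et => /=.
by move: (energy _) => e; nra.
Unshelve. all: by end_near. Qed.

End Conclusions.

Theorem mainTheorem6 (R : realType) (al la be : R)
    (al_gt2 : 2 < al) (la_gt0 : 0 < la) (be_gt0 : 0 < be) :
  (* (a) *)
  (forall mu : R, 0 < mu ->
    exists Ec : R, 0 < Ec < mu /\
      forall e : R, 0 < e < Ec -> Phi al la be mu e < 0) /\
  (* (b) *)
  (forall e : R, 0 < e < 1 ->
    forall mu : R, mass_threshold al la be e < mu -> Psi al la be mu e < 0) /\
  (forall (T : R) (f0 : R -> R) (f : R -> R -> R),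
    0 < T -> 0 < mass f0 -> smooth_solution al la be T f0 f ->
    let mu := mass f0 in
    let E := fun t : R => energy (f ^~ t) in
    let g := gamma al in
    let La := Lambda al be mu (E 0) in
    let tb := tbar al la be mu (E 0) in
    (* (c) *)
    [/\ 0 < g,
        forall t : R, 0 <= t < T ->
          E t >= (1 / 5) ^+ 5
                 * ((2 * Num.sqrt 2) ^+ 4 * mu ^+ 5 / sqL2norm (f ^~ t) ^+ 2),
        E 0 < (La / (2 * la * mu)) `^ g^-1 -> 0 < tb &
        Phi al la be mu (E 0) < 0 \/ Psi al la be mu (E 0 / mu) < 0 ->
        [/\ forall t : R, 0 < t < T ->
              [/\ derivable E t 1,
                  E^`()%classic t <= 2 * la * mu - La / E t `^ g &
                  2 * la * mu - La / E t `^ g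
                    <= - ((La - 2 * la * mu * E 0 `^ g) / E t `^ g)],
            forall t : R, 0 <= t < T ->
              E t `^ (g + 1)
                <= E 0 `^ (g + 1)
                   - (g + 1) * (La - 2 * la * mu * E 0 `^ g) * t,
            (* a solution that is smooth past tb would have E tb = 0,
               which the lower bound on E excludes *)
            (tb < T -> E tb = 0) /\ T <= tb &
            (* if it is smooth up to tb, E vanishes and the L^2 norm blows up *)
            tb <= T ->
              E t @[t --> tb^'-] --> (0 : R) /\
              Num.sqrt (sqL2norm (f ^~ t)) @[t --> tb^'-] --> +oo]] /\
    (* (d) *)
    (0 < tb <= T -> E t @[t --> tb^'-] --> (0 : R) ->
      [/\ mean (f ^~ t) @[t --> tb^'-] --> (0 : R),
          centered_energy (f ^~ t) @[t --> tb^'-] --> (0 : R) &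
          (* f(., t) dw converges weakly to mu times the Dirac mass at 0 *)
          forall phi : R -> R, {within `[(-1 : R), 1], continuous phi} ->
            intI (fun w => phi w * f w t) @[t --> tb^'-]
              --> mu * \int[\d_(0 : R)]_(w in `[(-1 : R), 1]) phi w])).
Proof.
split; first by move=> mu mu0; exact: Phi_lt0_small.
split; first by move=> e e01 mu; exact: Psi_lt0_large.
move=> T f0 f T0 mass0 sol mu E g La tb.
have zT : 0 <= (0 : R) < T by rewrite lexx.
have E_gt0 : forall t : R, 0 <= t < T -> 0 < E t := energy_gt0 mass0 sol.
have E_le : forall t : R, 0 <= t < T -> E t <= mu := energy_le_mass sol.
have g0 : 0 < g := gamma_gt0 al_gt2.
have g1 : 0 < g + 1 by rewrite addr_gt0.
split; last by move=> /andP[tb0 tbT]; exact: (concentration mass0 sol).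
split=> // [t|E0|PhiPsi]; first exact: (energy_ge mass0 sol).
  rewrite /tb /tbar -/La divr_gt0 ?powR_gt0 ?E_gt0// mulr_gt0// subr_gt0.
  have q0 : 0 <= La / (2 * la * mu).
    by rewrite divr_ge0 ?Lambda_ge0// !mulr_ge0// ltW.
  rewrite mulrC -ltr_pdivlMr ?mulr_gt0//.
  have -> : La / (2 * la * mu) = ((La / (2 * la * mu)) `^ g^-1) `^ g.
    by rewrite -powRrM mulVf ?gt_eqF// powRr1.
  by rewrite gt0_ltr_powR ?nnegrE ?powR_ge0// ltW ?E_gt0.
have Ph : Phi al la be mu (E 0) < 0.
  case: PhiPsi => // Ps.
  by rewrite Phi_Psi ?E_gt0 ?E_le// pmulr_rlt0.
have cE := energy_continuous sol.
have dE := energy_is_derive sol.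
have rate (t : R) (tT : 0 < t < T) :=
  energy_rate_le al_gt2 be_gt0 mass0 sol (ltW la_gt0) tT.
have Wt (t : R) : 0 < t < T -> 0 <= t < T by case/andP=> /ltW-> ->.
have Tb := extinction_bound al_gt2 la_gt0 be_gt0 mass0 T0 cE dE rate E_gt0 E_le Ph.
split.
- move=> t tT; split.
  + by case: (dE t tT).
  + have [_] := dE t tT; rewrite derive1E => ->.
    exact: (rate_le al_gt2 la_gt0 be_gt0 mass0 T0 cE dE rate E_gt0 E_le Ph).
  + exact: (rate_le_K al_gt2 la_gt0 be_gt0 mass0 T0 cE dE rate E_gt0 E_le Ph (Wt t tT)).
- move=> t tT.
  exact: (energy_power_decay al_gt2 la_gt0 be_gt0 mass0 T0 cE dE rate E_gt0 E_le Ph).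
- by split=> // tbT; move: (lt_le_trans tbT Tb); rewrite ltxx.
- move=> tbT.
  have Ecvg := energy_extinction al_gt2 la_gt0 be_gt0 mass0 T0 cE dE rate
    E_gt0 E_le Ph tbT.
  by split=> //; apply: (L2_blowup mass0 sol) => //; exact: lt_le_trans Tb.
Qed.
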